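(* Consider the mean-shift model $y=X\beta^\star+\mu^\star+\varepsilon$ with $X\in\mathbb{R}^{n\times p}$ deterministic with columns of unit Euclidean norm, $|\beta^\star|_0\le k$ and $|\mu^\star|_0\le s$ for positive integers $k,s$, and $\varepsilon\sim\mathcal N(0,\sigma^2I_n)$. Let $\lambda_i=\sigma\sqrt{\log(2n/i)}$ for $i=1,\dots,n$, $\tilde\lambda_j=\sigma\sqrt{\log(2p/j)}$ for $j=1,\dots,p$, let $\rho\ge2(4+\sqrt2)$, and let $$(\hat\beta,\hat\mu)\in\arg\min_{\beta\in\mathbb{R}^p,\mu\in\mathbb{R}^n}\Big\{\|y-X\beta-\mu\|_2^2+2\rho J_{\tilde\lambda}(\beta)+2\rho J_\lambda(\mu)\Big\}.$$ Let $k_1=k\log(2ep/k)/\log2$ and $s_1=s\log(2en/s)/\log2$, and suppose there are constants $\kappa_1>2\kappa_2>0$ such that for all $(\beta,\mu)\in\mathbb{R}^p\times\mathbb{R}^n$ satisfying $$\sum_{j=1}^p\frac{\tilde\lambda_j}{\tilde\lambda_p}|\beta|_{(j)}+\sum_{j=1}^n\frac{\lambda_j}{\lambda_n}|\mu|_{(j)}\le5\big(\sqrt{k_1}\|\beta\|_2+\sqrt{s_1}\|\mu\|_2\big)$$ one has $\|X\beta\|_2^2+\|\mu\|_2^2\ge\kappa_1(\|\beta\|_2^2+\|\mu\|_2^2)$ and $|\langle X\beta,\mu\rangle|\le\kappa_2(\|\beta\|_2^2+\|\mu\|_2^2)$. Let $\kappa=\sqrt{\kappa_1-2\kappa_2}$.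 Then there is a constant $C'>0$ depending only on $\rho$ such that, with probability at least $1-\frac12(s/2n)^s-\frac12(k/2p)^k$, $$\|\hat\beta-\beta^\star\|_2^2+\|\hat\mu-\mu^\star\|_2^2\le\frac{C'}{\kappa^4}\Big(\sum_{j=1}^k\tilde\lambda_j^2+\sum_{j=1}^s\lambda_j^2\Big)\le\frac{C'\sigma^2}{\kappa^4}\Big(k\log\Big(\frac{2ep}{k}\Big)+s\log\Big(\frac{2en}{s}\Big)\Big).$$
   Context: For $u\in\mathbb{R}^m$, $|u|_0$ is the number of nonzero entries of $u$, and $|u|_{(1)}\ge\dots\ge|u|_{(m)}$ are the absolute values of its entries sorted in non-increasing order. For a vector $\lambda\in\mathbb{R}^m$ with non-negative non-increasing entries, the sorted-$\ell_1$ norm is $J_\lambda(x)=\sum_{j=1}^m\lambda_j|x|_{(j)}$. *)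

(* Defs.v *)
From HB Require Import structures.
From mathcomp Require Import all_boot all_order all_algebra.
From mathcomp Require Import all_classical all_reals all_analysis.
Set Implicit Arguments. Unset Strict Implicit. Unset Printing Implicit Defensive.
Import Order.TTheory GRing.Theory Num.Theory.
Local Open Scope classical_set_scope.
Local Open Scope ring_scope.

Section Defs.
Variable R : realType.

Definition l0 {m} (u : 'cV[R]_m) : nat := #|[set i : 'I_m | u i 0 != 0]|.

Definition sqn {m} (u : 'cV[R]_m) : R := \sum_(i < m) u i 0 ^+ 2.
Definition l2 {m} (u : 'cV[R]_m) : R := Num.sqrt (sqn u).
Definition dotv {m} (u v : 'cV[R]_m) : R := \sum_(i < m) u i 0 * v i 0.

(* |u|_(1) >= ... >= |u|_(m): absolute values sorted non-increasingly;
   sorted_abs u j is |u|_(j+1) (0-based index j) *)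
Definition sorted_abs {m} (u : 'cV[R]_m) (j : nat) : R :=
  nth 0 (sort (fun a b : R => b <= a) [seq `|u i 0| | i <- enum 'I_m]) j.

(* sorted-l1 norm J_lam(x) = sum_{j=1}^m lam_j |x|_(j), with lam given
   1-based as a function on nat *)
Definition Jsl {m} (lam : nat -> R) (u : 'cV[R]_m) : R :=
  \sum_(j < m) lam j.+1 * sorted_abs u j.

Definition lamw (sigma : R) (m : nat) (i : nat) : R :=
  sigma * Num.sqrt (ln (2 * m%:R / i%:R)).

Definition indep_rvs d (T : measurableType d) (P : probability T R) m
  (e : 'I_m -> T -> R) : Prop :=
  forall A : 'I_m -> set R, (forall i, measurable (A i)) ->
    P (\bigcap_(i in [set: 'I_m]) (e i @^-1` A i)) =
    (\prod_(i < m) P (e i @^-1` A i))%E.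

End Defs.

(* Main.v *)
Require Import Defs.
From HB Require Import structures.
From mathcomp Require Import all_boot all_order all_algebra.
From mathcomp Require Import all_classical all_reals all_analysis.
From mathcomp Require Import fingroup perm measurable_realfun ring lra.
Import Order.TTheory GRing.Theory Num.Theory.
Local Open Scope classical_set_scope.
Local Open Scope ring_scope.
Set Implicit Arguments. Unset Strict Implicit. Unset Printing Implicit Defensive.

(** Noise: with J(u, v) the total penalty of u and v, one event carries
      <eps, X u + v> <= 32/5 J(u, v) + tau |X u + v|   for all u and v,
    where tau^2 is of order sigma^2 min(k log(2p/k), s log(2n/s)).  With
    probability at least 1/2 the bound 3 J(u, v) holds, by Markov's inequality
    for sums of exp(3 g^2 / (8 sigma^2)).  The other term comes from Gaussian
    concentration of suprema of linear forms, obtained by the Maurey-Pisier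
    rotation argument with only three rotations by pi/6; their second-order
    error is absorbed in the exponential moment, so no limit is needed, but the
    constant in front of the median doubles: whence 32/5 > 2 * 3.

    Using the joint direction X u + v in the noise bound, instead of X u and v
    separately, is what makes it compatible with the left-hand side
    |X u + v|^2 of the basic inequality.  Off the cone of the restricted
    eigenvalue condition, J(u, v) > 5 (A |u| + B |v|) with A and B the norms of
    the leading weights, and as 32/5 < 3 rho/5 the penalty itself is then at
    most of order tau^2, hence |u| + |v| is of order tau.  On the cone the
    restricted eigenvalue condition applies directly. *)

(** * Gaussian measure on the line and the plane *)

Section gauss_density.
Context {R : realType}.
Local Open Scope ereal_scope.
Notation leb := (@lebesgue_measure R).

(** The constants leave little room. At the smallest allowed [rho] the ceiling 3 rho/5 on the noise
    constant is about 6.497, while doubling the median constant 3 already costs 6. The value 32/5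
    lies in between: after division by the claimed bound, twice the median is 15/16, and the
    remaining 1/16 pays for the Gaussian variance term. The scale [tau] follows the smaller of the
    two complexities because off the cone tau (|u| + |v|) has to be dominated by a multiple of A |u|
    + B |v|. This is compatible with the confidence level: the allowed failure probability is half
    the sum of two terms, and the smaller complexity belongs to the larger of them. *)

Lemma ge0_integral_normal_prob (m sigma : R) (f : R -> \bar R) :
  measurable_fun setT f -> (forall x, 0 <= f x) ->
  \int[normal_prob m sigma]_x f x =
  \int[leb]_x (f x * (normal_pdf m sigma x)%:E).
Proof.
move=> mf f0.
have dom : normal_prob m sigma `<< leb by exact: normal_prob_dominates.
rewrite -(Radon_Nikodym_SigmaFinite.change_of_variables dom)//.
have mpdf : measurable_fun setT (fun x : R => (normal_pdf m sigma x)%:E).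
  by apply/measurable_EFinP; exact: measurable_normal_pdf.
apply: ae_eq_integral => //.
- apply: emeasurable_funM => //.
  exact: (measurable_int _ (Radon_Nikodym_SigmaFinite.f_integrable dom)).
- exact: emeasurable_funM.
(* The Radon-Nikodym derivative and the density have the same integral over every measurable set, so
   they agree almost everywhere. *)
- apply: ae_eqe_mul2l; apply: integral_ae_eq => //=.
  + exact: Radon_Nikodym_SigmaFinite.f_integrable.
  + by move=> E _ mE; rewrite -Radon_Nikodym_SigmaFinite.f_integral.
Qed.

Lemma lebesgue_measure_shift (a : R) (A : set R) : measurable A ->
  leb ((fun x => x + a)%R @^-1` A) = leb A.
Proof.
move=> mA.
have ms : measurable_fun [set: measurableTypeR R]
    (fun x => (x : R) + a : measurableTypeR R)%R.
  exact: (@measurable_funD _ R R setT id (cst a)).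
apply/esym.
pose mu : {measure set (measurableTypeR R) -> \bar R} :=
  measure_function_pushforward__canonical__measure_function_Measure leb ms.
apply: (@lebesgue_measure_unique R mu) => //.
move=> X [[b c] /= _ <-].
rewrite /mu /pushforward /=.
rewrite (_ : _ @^-1` _ = `](b - a), (c - a)]%classic)%R; last first.
  by apply/seteqP; split => x /=; rewrite !in_itv/= ltrBlDr lerBrDr.
by rewrite !lebesgue_measure_itv/= !lte_fin ltrD2r; case: ifP => // _; rewrite -!EFinB; congr EFin; lra.
Qed.

Lemma ge0_integral_shift (a : R) (f : R -> \bar R) :
  measurable_fun setT f -> (forall x, 0 <= f x) ->
  \int[leb]_x f (x + a)%R = \int[leb]_x f x.
Proof.
move=> mf f0.
have ms : measurable_fun [set: measurableTypeR R]
    (fun x => (x : R) + a : measurableTypeR R)%R.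
  exact: (@measurable_funD _ R R setT id (cst a)).
have := @ge0_integral_pushforward _ _ _ _ R _ ms leb setT f measurableT mf (fun x _ => f0 x).
rewrite preimage_setT /= => <-.
apply: eq_measure_integral => A mA _ .
by rewrite /= /pushforward lebesgue_measure_shift.
Qed.

(** Completing the square: the centred density tilted by [expR (a * x)] is, up to a constant, the
    density with mean [a * sigma ^+ 2]. *)
Lemma normal_mgf (sigma a : R) : (0 < sigma)%R ->
  \int[normal_prob 0 sigma]_x (expR (a * x))%:E = (expR (a ^+ 2 * sigma ^+ 2 / 2))%:E.
Proof.
move=> s0; rewrite ge0_integral_normal_prob//; last first.
  by apply/measurable_EFinP; apply: measurableT_comp => //; exact: measurable_funM.
transitivity (\int[leb]_x ((expR (a ^+ 2 * sigma ^+ 2 / 2))%:E * (normal_pdf (a * sigma ^+ 2) sigma x)%:E)).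
  apply: eq_integral => x _; rewrite -!EFinM; congr EFin.
  rewrite !normal_pdfE ?gt_eqF// /normal_fun.
  rewrite !(mulrCA _ (normal_peak _)); congr (_ * _)%R.
  rewrite -!expRD; congr expR; field; exact: lt0r_neq0.
rewrite ge0_integralZl//; last 2 first.
- by apply/measurable_EFinP; exact: measurable_normal_pdf.
- by move=> x _; rewrite lee_fin normal_pdf_ge0.
by rewrite integral_normal_pdf mule1.
Qed.

(** As 3/8 - 1/2 = -1/8, the integrand is a normal density of standard deviation [2 * sigma], up to
    the ratio 2 of the peaks. *)
Lemma normal_exp_sqr (sigma : R) : (0 < sigma)%R ->
  \int[normal_prob 0 sigma]_x (expR (3 / 8 * x ^+ 2 / sigma ^+ 2))%:E = 2%:E.
Proof.
move=> s0; rewrite ge0_integral_normal_prob//; last first.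
  apply/measurable_EFinP; apply: measurableT_comp => //; apply: measurable_funM => //.
  by apply: measurable_funM => //; apply: measurable_funX.
transitivity (\int[leb]_x (2%:E * (normal_pdf 0 (2 * sigma) x)%:E)).
  apply: eq_integral => x _; rewrite -!EFinM; congr EFin.
  rewrite !normal_pdfE ?gt_eqF ?mulr_gt0// /normal_fun.
  rewrite (_ : normal_peak sigma = 2 * normal_peak (2 * sigma))%R; last first.
    rewrite /normal_peak exprMn -[in RHS]mulrA -[in RHS]mulrnAr (sqrtrM (_ *+ 2)) ?sqr_ge0//.
    by rewrite sqrtr_sqr ger0_norm// invfM mulrA divff ?mul1r.
  rewrite mulrCA -!mulrA; congr (_ * (_ * _))%R.
  rewrite -!expRD; congr expR; field; exact: lt0r_neq0.
rewrite ge0_integralZl//; last 2 first.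
- by apply/measurable_EFinP; exact: measurable_normal_pdf.
- by move=> x _; rewrite lee_fin normal_pdf_ge0.
by rewrite integral_normal_pdf mule1.
Qed.

Lemma lebesgue_shear1 (a : R) (G : R * R -> \bar R) :
  measurable_fun setT G -> (forall z, 0 <= G z) ->
  \int[leb]_x \int[leb]_y G (x + a * y, y)%R = \int[leb]_x \int[leb]_y G (x, y).
Proof.
move=> mG G0.
have msh : measurable_fun setT (fun z : R * R => (z.1 + a * z.2, z.2)%R).
  apply: measurable_fun_pair => //.
  by apply: measurable_funD => //; apply: measurable_funM.
transitivity (\int[leb]_y \int[leb]_x G (x + a * y, y)%R).
  apply: (@fubini_tonelli _ _ _ _ R leb leb (fun z : R * R => G (z.1 + a * z.2, z.2)%R)) => //.
  exact: measurableT_comp.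
transitivity (\int[leb]_y \int[leb]_x G (x, y)); last first.
  by apply/esym; exact: (@fubini_tonelli _ _ _ _ R leb leb G).
apply: eq_integral => y _.
rewrite (ge0_integral_shift (a * y) (f := fun x => G (x, y)))//.
exact: measurable_fun_pair1.
Qed.

Lemma lebesgue_shear2 (a : R) (G : R * R -> \bar R) :
  measurable_fun setT G -> (forall z, 0 <= G z) ->
  \int[leb]_x \int[leb]_y G (x, y + a * x)%R = \int[leb]_x \int[leb]_y G (x, y).
Proof.
move=> mG G0.
apply: eq_integral => x _.
rewrite (ge0_integral_shift (a * x) (f := fun y => G (x, y)))//.
exact: measurable_fun_pair2.
Qed.

(** A rotation is a product of three shears, with [t] the tangent of half the angle. For one
    coordinate fixed, a shear is a translation of the other, so translation invariance and Tonelli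
    suffice. *)
Lemma lebesgue_rotation (c s : R) (G : R * R -> \bar R) :
  (c ^+ 2 + s ^+ 2 = 1)%R -> (s != 0)%R ->
  measurable_fun setT G -> (forall z, 0 <= G z) ->
  \int[leb]_x \int[leb]_y G (c * x + s * y, - s * x + c * y)%R =
  \int[leb]_x \int[leb]_y G (x, y).
Proof.
move=> cs s0 mG G0; set t : R := ((1 - c) / s)%R.
have ts : (t * s = 1 - c)%R by rewrite /t divfK.
have tc : (t * (1 + c) = s)%R.
  apply: (mulIf s0); rewrite mulrAC ts -expr2.
  transitivity (1 - c ^+ 2)%R; first by ring.
  by rewrite -cs; ring.
have m1 (a : R) (H : R * R -> \bar R) : measurable_fun setT H ->
    measurable_fun setT (fun z : R * R => H (z.1 + a * z.2, z.2)%R).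
  move=> mH; apply: measurableT_comp => //; apply: measurable_fun_pair => //=.
  by apply: measurable_funD => //; apply: measurable_funM.
have m2 (a : R) (H : R * R -> \bar R) : measurable_fun setT H ->
    measurable_fun setT (fun z : R * R => H (z.1, z.2 + a * z.1)%R).
  move=> mH; apply: measurableT_comp => //; apply: measurable_fun_pair => //=.
  by apply: measurable_funD => //; apply: measurable_funM.
rewrite -(lebesgue_shear1 t mG G0).
rewrite -(lebesgue_shear2 (- s) (G := fun z : R * R => G (z.1 + t * z.2, z.2)%R))//; last exact: m1.
rewrite -[RHS](lebesgue_shear1 t (G := fun z : R * R => G (z.1 + t * (z.2 + - s * z.1), z.2 + - s * z.1)%R))//=; last first.
  exact: (m2 _ (fun z : R * R => G (z.1 + t * z.2, z.2)%R) (m1 _ _ mG)).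
apply: eq_integral => x _; apply: eq_integral => y _; congr (G (_, _)).
- transitivity (x * (1 - t * s) + y * (t * (2 - t * s)))%R; last by ring.
  by rewrite ts (_ : 2 - (1 - c) = 1 + c)%R ?tc; ring.
- transitivity (- s * x + y * (1 - t * s))%R; last by ring.
  by rewrite ts; ring.
Qed.

Lemma normal_rotation (sigma c s : R) (F : R * R -> \bar R) : (0 < sigma)%R ->
  (c ^+ 2 + s ^+ 2 = 1)%R -> (s != 0)%R ->
  measurable_fun setT F -> (forall z, 0 <= F z) ->
  let g : probability (measurableTypeR R) R := normal_prob 0 sigma in
  \int[g]_x \int[g]_y F (c * x + s * y, - s * x + c * y)%R =
  \int[g]_x \int[g]_y F (x, y).
Proof.
move=> sg0 cs s0 mF F0 g.
pose p x := (normal_pdf 0 sigma x)%:E : \bar R.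
have p0 x : 0 <= p x by rewrite lee_fin normal_pdf_ge0.
have mp : measurable_fun setT p.
  by apply/measurable_EFinP; exact: measurable_normal_pdf.
have red (H : R * R -> \bar R) : measurable_fun setT H -> (forall z, 0 <= H z) ->
    \int[g]_x \int[g]_y H (x, y) = \int[leb]_x \int[leb]_y (H (x, y) * p y * p x).
  move=> mH H0; rewrite ge0_integral_normal_prob//; last 2 first.
    exact: (@measurable_fun_fubini_tonelli_F _ _ _ _ R g H).
    by move=> x; apply: integral_ge0.
  apply: eq_integral => x _.
  rewrite ge0_integral_normal_prob//; last exact: measurable_fun_pair2.
  rewrite ge0_integralZr//.
    by apply: emeasurable_funM => //; exact: measurable_fun_pair2.
  by move=> y _; rewrite mule_ge0.
rewrite (red (fun z : R * R => F (c * z.1 + s * z.2, - s * z.1 + c * z.2)%R))//=; last first.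
  apply: measurableT_comp => //; apply: measurable_fun_pair => //=.
    by apply: measurable_funD => //; apply: measurable_funM.
  by apply: measurable_funD => //; apply: measurable_funM.
transitivity (\int[leb]_x \int[leb]_y (F (x, y) * p y * p x)); last first.
  by apply/esym; exact: red.
have -> : \int[leb]_x \int[leb]_y (F (x, y) * p y * p x) =
    \int[leb]_x \int[leb]_y (fun z : R * R => F z * p z.2 * p z.1)
      (c * x + s * y, - s * x + c * y)%R.
  apply/esym/(lebesgue_rotation cs s0 (G := fun z : R * R => F z * p z.2 * p z.1)); last first.
- by move=> z; rewrite !mule_ge0.
- by apply: emeasurable_funM => //=; [apply: emeasurable_funM => //|];
    exact: measurableT_comp.
apply: eq_integral => x _; apply: eq_integral => y _ /=.
rewrite -!muleA; congr (_ * _); rewrite /p -!EFinM; congr EFin.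
rewrite !normal_pdfE ?gt_eqF// /normal_fun.
rewrite !mulrA !(mulrAC _ (expR _) (normal_peak _)) -!mulrA.
congr (_ * (_ * _))%R; rewrite -!expRD; congr expR.
rewrite -!mulrDl; congr (_ / _)%R.
transitivity (- (c ^+ 2 + s ^+ 2) * (x ^+ 2 + y ^+ 2))%R; last by ring.
by rewrite cs; ring.
Qed.

End gauss_density.

(** * Finite products of a probability measure *)

Section iid_product.
Context {R : realType} {d : measure_display} {S : measurableType d}.
Variable mu : probability S R.
Local Open Scope ereal_scope.

Definition tcons n (z : S * n.-tuple S) : n.+1.-tuple S := [tuple of z.1 :: z.2].

Lemma measurable_tcons n : measurable_fun setT (@tcons n).
Proof. exact: measurable_cons. Qed.

HB.instance Definition _ n :=
  isMeasurableFun.Build _ _ _ _ (@tcons n) (@measurable_tcons n).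

(** The first coordinate is split off so that integrals are computed by induction; the pushforward
    along [tcons] makes the carrier a tuple instead of a nested product. *)
Fixpoint iidp n : probability (n.-tuple S) R :=
  match n with
  | 0 => dirac [tuple]
  | m.+1 => distribution (mu \x iidp m) (@tcons m)
  end.

Lemma tnth_tconsS n (z : S * n.-tuple S) i : tnth (tcons z) (lift ord0 i) = tnth z.2 i.
Proof. by rewrite /tcons /= tnthS. Qed.

Lemma integral_iidp0 (f : 0.-tuple S -> \bar R) :
  measurable_fun setT f -> \int[iidp 0]_t f t = f [tuple].
Proof. by move=> mf; rewrite integral_dirac// diracT mul1e. Qed.

Lemma integral_iidpS n (f : n.+1.-tuple S -> \bar R) :
  measurable_fun setT f -> (forall t, 0 <= f t) ->
  \int[iidp n.+1]_t f t = \int[mu]_x \int[iidp n]_t f (tcons (x, t)).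
Proof.
move=> mf f0; rewrite /= ge0_integral_distribution//.
rewrite (fubini_tonelli1 (f \o @tcons n))//; last by move=> x /=.
by apply: measurableT_comp => //; exact: measurable_tcons.
Qed.

Lemma measurable_box n (A : 'I_n -> set S) : (forall i, measurable (A i)) ->
  measurable [set t : n.-tuple S | forall i, A i (tnth t i)].
Proof.
move=> mA.
rewrite (_ : [set t | _] = \big[setI/setT]_(i < n) ((fun t => tnth t i) @^-1` A i)).
  apply: bigsetI_measurable => i _; rewrite -[X in measurable X]setTI.
  exact: (measurable_tnth i).
rewrite -bigcap_seq/=; apply/seteqP; split => t /= h; first by move=> i _; exact: h.
by move=> i; apply: (h i); rewrite /= mem_index_enum.
Qed.

Lemma iidp_box n (A : 'I_n -> set S) : (forall i, measurable (A i)) ->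
  iidp n [set t | forall i, A i (tnth t i)] = \prod_(i < n) mu (A i).
Proof.
elim: n A => [|n IH] A mA.
  rewrite big_ord0 /= diracE mem_set//= => -[].
  by case.
rewrite big_ord_recl /= /distribution /pushforward.
rewrite (_ : _ @^-1` _ = A ord0 `*` [set t : n.-tuple S | forall i : 'I_n, A (lift ord0 i) (tnth t i)]).
  rewrite product_measure1E//; last by apply: (@measurable_box n (fun i => A (lift ord0 i))).
  by congr (_ * _); exact: (IH (fun i => A (lift ord0 i))).
apply/seteqP; split => -[x t] /=.
  move=> h; split; first by have := h ord0.
  by move=> i; have := h (lift ord0 i); rewrite tnth_tconsS.
move=> [h0 hS] i; case: (unliftP ord0 i) => [j ->|-> //].
by rewrite tnth_tconsS.
Qed.

(** Boxes are closed under intersection and generate the product sigma-algebra. *)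
Lemma tuple_prob_unique n (P Q : probability (n.-tuple S) R) :
  (forall A : 'I_n -> set S, (forall i, measurable (A i)) ->
     P [set t | forall i, A i (tnth t i)] = Q [set t | forall i, A i (tnth t i)]) ->
  forall B, measurable B -> P B = Q B.
Proof.
move=> h B mB.
pose G : set (set (n.-tuple S)) := [set C | exists2 A : 'I_n -> set S,
  forall i, measurable (A i) & C = [set t | forall i, A i (tnth t i)]].
apply: (measure_unique G (fun=> setT)) => //.
- apply/seteqP; split.
    apply: sub_sigma_algebra2; rewrite -bigcup_seq => C [i _ [D mD <-]].
    exists (fun j => if j == i then D else setT).
      by move=> j; case: ifP.
    apply/seteqP; split => t /=; first by move=> [_ Dt] j; case: eqP => [->|].
    by move=> /(_ i); rewrite eqxx.
  move=> C; rewrite /measurable/=; apply: smallest_sub; first exact: sigma_algebra_measurable.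
  by move=> _ [A mA ->]; exact: measurable_box.
- move=> _ _ [A mA ->] [A' mA' ->]; exists (fun i => A i `&` A' i).
    by move=> i; exact: measurableI.
  apply/seteqP; split => t /=; first by move=> [h1 h2] i; split.
  by move=> h12; split => i; case: (h12 i).
- move=> _; exists (fun=> setT) => //; apply/seteqP; split => //.
- by rewrite bigcup_const.
- by move=> _ [A mA ->]; exact: h.
- by move=> _; rewrite (le_lt_trans (probability_le1 _ _))// ltry.
Qed.

Lemma integral_iidp_map n (T : S -> S) : measurable_fun setT T ->
  (forall f : S -> \bar R, measurable_fun setT f -> (forall x, 0 <= f x) ->
     \int[mu]_x f (T x) = \int[mu]_x f x) ->
  forall F : n.-tuple S -> \bar R, measurable_fun setT F -> (forall t, 0 <= F t) ->
    \int[iidp n]_t F [tuple of map T t] = \int[iidp n]_t F t.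
Proof.
move=> mT hT.
have mm m : measurable_fun setT (fun t : m.-tuple S => [tuple of map T t]).
  apply/measurable_fun_tnthP => i /=.
  rewrite (_ : _ \o _ = T \o (fun t => tnth t i)); last first.
    by apply/funext => t /=; rewrite tnth_map.
  by apply: measurableT_comp => //; exact: measurable_tnth.
elim: n => [|n IH] F mF F0.
  rewrite !integral_iidp0//; last exact: (measurableT_comp mF (mm 0%N)).
  by congr F; apply: val_inj.
rewrite integral_iidpS//; last exact: (measurableT_comp mF (mm n.+1)).
rewrite [RHS]integral_iidpS//.
have mFc : measurable_fun setT (F \o @tcons n).
  by apply: measurableT_comp => //; exact: measurable_tcons.
transitivity (\int[mu]_x \int[iidp n]_t F (tcons (T x, t))).
  apply: eq_integral => x _.
  rewrite -(IH (fun t => F (tcons (T x, t))))//.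
    by apply: eq_integral => t _; congr F; apply: val_inj.
  exact: (measurable_fun_pair2 _ mFc).
apply: (hT (fun x => \int[iidp n]_t F (tcons (x, t)))).
  by apply: (measurable_fun_fubini_tonelli_F (F \o @tcons n)) => // z /=.
by move=> x; apply: integral_ge0.
Qed.

End iid_product.

Section iid_pairs.
Context {R : realType} {d1 d2 : measure_display}.
Context {S1 : measurableType d1} {S2 : measurableType d2}.
Variables (mu1 : probability S1 R) (mu2 : probability S2 R).
Local Open Scope ereal_scope.

Definition unzip_tuple n (z : n.-tuple (S1 * S2)) : n.-tuple S1 * n.-tuple S2 :=
  ([tuple of map fst z], [tuple of map snd z]).

Lemma measurable_unzip_tuple n : measurable_fun setT (@unzip_tuple n).
Proof.
apply: measurable_fun_pair; apply/measurable_fun_tnthP => i /=.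
- rewrite (_ : _ \o _ = fst \o (fun t => tnth t i)); last first.
    by apply/funext => t /=; rewrite tnth_map.
  by apply: measurableT_comp => //; exact: measurable_tnth.
- rewrite (_ : _ \o _ = snd \o (fun t => tnth t i)); last first.
    by apply/funext => t /=; rewrite tnth_map.
  by apply: measurableT_comp => //; exact: measurable_tnth.
Qed.

(** A vector of independent pairs is a pair of independent vectors. A rotation mixing two Gaussian
    vectors therefore acts on each pair of coordinates separately, where invariance in the plane and
    [integral_iidp_map] apply. *)
Lemma integral_iidp_unzip n (F : n.-tuple S1 * n.-tuple S2 -> \bar R) :
  measurable_fun setT F -> (forall t, 0 <= F t) ->
  \int[iidp (mu1 \x mu2) n]_z F (unzip_tuple z) =
  \int[iidp mu1 n]_x \int[iidp mu2 n]_y F (x, y).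
Proof.
elim: n F => [|n IH] F mF F0.
  rewrite !integral_iidp0//.
  - by congr F; congr pair; apply: val_inj.
  - exact: measurable_fun_pair2.
  - exact: (measurable_fun_fubini_tonelli_F F).
  - exact: (measurableT_comp mF (@measurable_unzip_tuple 0)).
rewrite integral_iidpS//; last exact: (measurableT_comp mF (@measurable_unzip_tuple n.+1)).
pose H (q : (S1 * S2) * (n.-tuple S1 * n.-tuple S2)) :=
  F (tcons (q.1.1, q.2.1), tcons (q.1.2, q.2.2)).
have mH : measurable_fun setT H.
  apply: measurableT_comp => //; apply: measurable_fun_pair;
   (apply: measurableT_comp; first exact: measurable_tcons);
   by apply: measurable_fun_pair => //; apply: measurableT_comp.
have H0 q : 0 <= H q by exact: F0.
transitivity (\int[mu1 \x mu2]_ab \int[iidp mu1 n]_x \int[iidp mu2 n]_y H (ab, (x, y))).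
  apply: eq_integral => ab _.
  rewrite -(IH (fun xy => H (ab, xy)))//; last exact: measurable_fun_pair2.
  by apply: eq_integral => z _; rewrite /H; congr F; congr pair; apply: val_inj.
have mH2 : measurable_fun setT (fun q : (S1 * S2) * n.-tuple S1 =>
    \int[iidp mu2 n]_y H (q.1, (q.2, y))).
  apply: (measurable_fun_fubini_tonelli_F (fun r : ((S1 * S2) * n.-tuple S1) * n.-tuple S2 =>
     H (r.1.1, (r.1.2, r.2)))) => //.
  apply: measurableT_comp => //; apply: measurable_fun_pair; first exact: measurableT_comp.
  by apply: measurable_fun_pair => //; exact: measurableT_comp.
rewrite (fubini_tonelli1 (fun ab => \int[iidp mu1 n]_x \int[iidp mu2 n]_y H (ab, (x, y))))//; first last.
- by move=> z; apply: integral_ge0 => ? _; apply: integral_ge0.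
- apply: (measurable_fun_fubini_tonelli_F (fun q : (S1 * S2) * n.-tuple S1 =>
    \int[iidp mu2 n]_y H (q.1, (q.2, y)))) => //.
  by move=> q; apply: integral_ge0.
rewrite integral_iidpS//; first last.
- by move=> t; apply: integral_ge0.
- exact: (measurable_fun_fubini_tonelli_F F).
apply: eq_integral => a _; rewrite /fubini_F.
rewrite (fubini_tonelli (fun q : S2 * n.-tuple S1 => \int[iidp mu2 n]_y H ((a, q.1), (q.2, y))))//=; first last.
- by move=> q; apply: integral_ge0.
- apply: (measurableT_comp (f := fun q : (S1 * S2) * n.-tuple S1 =>
    \int[iidp mu2 n]_y H (q.1, (q.2, y))) mH2 (g := fun q : S2 * n.-tuple S1 => ((a, q.1), q.2))).
  by apply: measurable_fun_pair => //; apply: measurable_fun_pair.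
apply: eq_integral => x _.
rewrite integral_iidpS//.
exact: measurable_fun_pair2.
Qed.

End iid_pairs.

(** * Gaussian vectors *)

Section gauss_vector.
Context {R : realType}.
Variable sigma : R.
Hypothesis sigma_gt0 : 0 < sigma.
Notation RR := (measurableTypeR R).
Let g : probability RR R := normal_prob 0 sigma.

Definition dott n (w : 'I_n -> R) (x : n.-tuple RR) : R :=
  \sum_(i < n) w i * (tnth x i : R).

Definition lcomb n (a b : R) (x y : n.-tuple RR) : n.-tuple RR :=
  [tuple (a * (tnth x i : R) + b * (tnth y i : R) : RR) | i < n].

Lemma dott_lcomb n w a b (x y : n.-tuple RR) :
  dott w (lcomb a b x y) = a * dott w x + b * dott w y.
Proof.
rewrite /dott !mulr_sumr -big_split/=; apply: eq_bigr => i _.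
by rewrite tnth_mktuple; ring.
Qed.

Lemma lcomb01 n (x y : n.-tuple RR) : lcomb 0 1 x y = y.
Proof. by apply: eq_from_tnth => i; rewrite tnth_mktuple mul0r add0r mul1r. Qed.

Lemma measurable_dott d (T : measurableType d) n (w : T -> 'I_n -> R) (x : T -> n.-tuple RR) :
  (forall i, measurable_fun setT (fun t => w t i)) -> measurable_fun setT x ->
  measurable_fun setT (fun t => dott (w t) (x t)).
Proof.
move=> mw mx; apply: measurable_sum => i; apply: measurable_funM => //.
exact: (measurableT_comp (measurable_tnth i) mx).
Qed.

Lemma measurable_lcomb n (a b : R) :
  measurable_fun setT (fun z : n.-tuple RR * n.-tuple RR => lcomb a b z.1 z.2).
Proof.
apply/measurable_fun_tnthP => i /=.
rewrite (_ : _ \o _ = fun z : n.-tuple RR * n.-tuple RR =>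
  (a * (tnth z.1 i : R) + b * (tnth z.2 i : R))); last first.
  by apply/funext => z /=; rewrite tnth_mktuple.
have m1 : measurable_fun setT (fun z : n.-tuple RR * n.-tuple RR => (tnth z.1 i : R)).
  exact: (measurableT_comp (measurable_tnth i) measurable_fst).
have m2 : measurable_fun setT (fun z : n.-tuple RR * n.-tuple RR => (tnth z.2 i : R)).
  exact: (measurableT_comp (measurable_tnth i) measurable_snd).
by apply: measurable_funD; apply: measurable_funM.
Qed.

Local Open Scope ereal_scope.

Lemma gauss_mgf n (a : 'I_n -> R) :
  \int[iidp g n]_x (expR (dott a x))%:E = (expR (sigma ^+ 2 / 2 * \sum_(i < n) a i ^+ 2))%:E.
Proof.
have me m (b : 'I_m -> R) : measurable_fun setT (fun x => (expR (dott b x))%:E).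
  by apply/measurable_EFinP; apply: measurableT_comp => //; exact: measurable_dott.
elim: n a => [|n IH] a.
  by rewrite integral_iidp0// /dott !big_ord0 mulr0.
rewrite integral_iidpS//.
pose b (i : 'I_n) := a (lift ord0 i).
have dE x t : dott a (tcons (x, t)) = (a ord0 * (x : R) + dott b t)%R.
  rewrite /dott big_ord_recl; congr (_ + _)%R.
  by apply: eq_bigr => i _; rewrite tnth_tconsS.
transitivity (\int[g]_x ((expR (a ord0 * (x : R)))%:E * (expR (sigma ^+ 2 / 2 * \sum_(i < n) b i ^+ 2))%:E)).
  apply: eq_integral => x _; rewrite -IH -ge0_integralZl//; last exact: me.
  by apply: eq_integral => t _; rewrite dE expRD EFinM.
rewrite ge0_integralZr//; last first.
  by apply/measurable_EFinP; apply: measurableT_comp => //; exact: measurable_funM.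
rewrite normal_mgf// -EFinM -expRD big_ord_recl; congr (expR _)%:E.
by rewrite /b; field.
Qed.

Lemma gauss_rotation n (c s : R) (F : n.-tuple RR * n.-tuple RR -> \bar R) :
  (c ^+ 2 + s ^+ 2 = 1)%R -> (s != 0)%R ->
  measurable_fun setT F -> (forall z, 0 <= F z) ->
  \int[iidp g n]_x \int[iidp g n]_y F (lcomb c s x y, lcomb (- s) c x y) =
  \int[iidp g n]_x \int[iidp g n]_y F (x, y).
Proof.
move=> cs s0 mF F0.
pose rot (z : RR * RR) : RR * RR :=
  ((c * (z.1 : R) + s * (z.2 : R))%R, (- s * (z.1 : R) + c * (z.2 : R))%R).
have mrot : measurable_fun setT rot.
  have m1 : measurable_fun setT (fun z : RR * RR => (z.1 : R)) by exact: measurable_fst.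
  have m2 : measurable_fun setT (fun z : RR * RR => (z.2 : R)) by exact: measurable_snd.
  by apply: measurable_fun_pair; apply: measurable_funD; apply: measurable_funM.
have inv (f : RR * RR -> \bar R) : measurable_fun setT f -> (forall x, 0 <= f x) ->
    \int[g \x g]_z f (rot z) = \int[g \x g]_z f z.
  move=> mf f0; rewrite (fubini_tonelli1 (f \o rot))//; last 2 first.
  - exact: measurableT_comp.
  - by move=> z /=.
  rewrite (fubini_tonelli1 f)//.
  exact: (@normal_rotation R sigma c s f).
transitivity (\int[iidp (g \x g) n]_z F (unzip_tuple [tuple of map rot z])).
  rewrite -(integral_iidp_unzip g g (F := fun z => F (lcomb c s z.1 z.2, lcomb (- s) c z.1 z.2)))//; last first.
    by apply: measurableT_comp => //; apply: measurable_fun_pair; exact: measurable_lcomb.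
  apply: eq_integral => z _; congr F; congr pair; apply: eq_from_tnth => i;
   by rewrite !(tnth_mktuple, tnth_map).
rewrite (integral_iidp_map mrot inv (F := F \o @unzip_tuple _ _ _ _ n)); first last.
- by move=> t /=.
- by apply: measurableT_comp => //; exact: measurable_unzip_tuple.
exact: integral_iidp_unzip.
Qed.

End gauss_vector.

(** * Concentration of the maximum of linear forms *)

Section measurable_comparison.
Context {R : realType} d (T : measurableType d) (f g : T -> R).
Hypotheses (mf : measurable_fun setT f) (mg : measurable_fun setT g).

Lemma measurable_set_le : measurable [set x | f x <= g x].
Proof.
rewrite -[X in measurable X]setTI.
have /(_ measurableT [set true]) := measurable_fun_ler mf mg.
exact.
Qed.

Lemma measurable_set_lt : measurable [set x | f x < g x].
Proof.
rewrite -[X in measurable X]setTI.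
have /(_ measurableT [set true]) := measurable_fun_ltr mf mg.
exact.
Qed.

End measurable_comparison.

Section gauss_concentration.
Context {R : realType}.
Variables (sigma : R) (n : nat) (w : nat -> 'I_n -> R).
Hypothesis sigma_gt0 : 0 < sigma.
Notation RR := (measurableTypeR R).
Let g : probability RR R := normal_prob 0 sigma.
Let G := iidp g n.

(** A measurable selection of a maximising form among the first [N] and the zero form, which keeps
    the maximum nonnegative. At [x] it is a subgradient of the convex function [maxdot N]. *)
Fixpoint best N (x : n.-tuple RR) : 'I_n -> R :=
  if N is M.+1 then
    if dott (best M x) x <= dott (w M) x then w M else best M x
  else fun=> 0.

Lemma best_ind (P : ('I_n -> R) -> Prop) N x : P (fun=> 0) ->
  (forall k, (k < N)%N -> P (w k)) -> P (best N x).
Proof.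
move=> P0; elim: N => [//|N IH] Pw /=; case: ifP => _; first exact: Pw.
by apply: IH => k kN; apply: Pw; rewrite ltnS ltnW.
Qed.

Definition maxdot N x := dott (best N x) x.

Lemma maxdot_ge N x k : (k < N)%N -> dott (w k) x <= maxdot N x.
Proof.
rewrite /maxdot; elim: N => [//|N IH] /=; rewrite ltnS leq_eqVlt => /predU1P[->|kN].
  by case: ifP => //; move/negbT; rewrite -ltNge => /ltW.
by case: ifP => h; rewrite ?(le_trans (IH kN)).
Qed.

Lemma dott0 (x : n.-tuple RR) : dott (fun=> 0) x = 0.
Proof. by rewrite /dott big1// => i _; rewrite mul0r. Qed.

Lemma maxdot_ge0 N x : 0 <= maxdot N x.
Proof.
rewrite /maxdot; elim: N => [|N IH] /=; first by rewrite dott0.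
by case: ifP => // h; exact: le_trans h.
Qed.

Lemma best_le_maxdot N x y : dott (best N x) y <= maxdot N y.
Proof.
by apply: (best_ind (P := fun v => dott v y <= maxdot N y)) => [|k kN]; [rewrite dott0 maxdot_ge0|exact: maxdot_ge].
Qed.

Lemma measurable_best N i : measurable_fun setT (fun x => best N x i).
Proof.
elim: N i => [|N IH] i /=; first exact: measurable_cst.
rewrite (_ : (fun x => _) = (fun x => if dott (best N x) x <= dott (w N) x
   then w N i else best N x i)); last by apply/funext => x; case: ifP.
apply: measurable_fun_ifT => //.
by apply: measurable_fun_ler; exact: measurable_dott.
Qed.

Lemma measurable_maxdot N : measurable_fun setT (maxdot N).
Proof. by apply: measurable_dott => // i; exact: measurable_best. Qed.

(** Here [z.1] is a point of the rotation path and [z.2] the velocity there. The summand with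
    [1 - c] is the second-order error of the finite step; the factor 3 is the cube from the
    arithmetic-geometric mean inequality over three steps. *)
Definition rotation_bound N (th c s : R) (z : n.-tuple RR * n.-tuple RR) : R :=
  expR (3 * th * ((1 - c) * maxdot N z.1 + s * dott (best N z.1) z.2)).

Lemma amgm3 (a b c : R) : 0 <= a -> 0 <= b -> 0 <= c ->
  a * b * c <= (a ^+ 3 + b ^+ 3 + c ^+ 3) / 3.
Proof.
move=> a0 b0 c0; rewrite ler_pdivlMr// -subr_ge0.
rewrite (_ : _ - _ = (a + b + c) * ((a - b) ^+ 2 + (b - c) ^+ 2 + (a - c) ^+ 2) / 2); last by field.
by rewrite divr_ge0// mulr_ge0// ?addr_ge0// ?sqr_ge0.
Qed.

(* Three rotations by pi/6 lead from x to y; on each the increment of the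
   convex function maxdot is bounded by its subgradient. *)
Lemma maxdot_rotation N (th c s : R) x y : 0 <= th -> s = 2^-1 -> c ^+ 2 = 3 / 4 ->
  expR (th * (maxdot N y - maxdot N x)) <=
  (rotation_bound N th c s (lcomb c s x y, lcomb (- s) c x y) +
   rotation_bound N th c s (lcomb s c x y, lcomb (- c) s x y) +
   rotation_bound N th c s (lcomb 0 1 x y, lcomb (- 1) 0 x y)) / 3.
Proof.
move=> th0 sE cE.
(* Turning back from [X] with velocity [X'] gives the preceding point [Z]. The subgradient is taken
   at the later point [X], so that [X] and [X'] are again independent with the law of [x] and
   [y]. *)
have step X X' Z : (forall v, dott v Z = c * dott v X - s * dott v X') ->
    maxdot N X - maxdot N Z <= (1 - c) * maxdot N X + s * dott (best N X) X'.
  move=> h; have := best_le_maxdot N X Z; rewrite h -/(maxdot N X); lra.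
set X1 := lcomb c s x y; set X1' := lcomb (- s) c x y.
set X2 := lcomb s c x y; set X2' := lcomb (- c) s x y.
set X3 := lcomb 0 1 x y; set X3' := lcomb (- 1) 0 x y.
have s2 : s * s = 1 / 4 by rewrite sE; field.
have c2 : c * c = 3 / 4 by rewrite -expr2.
have h1 := step X1 X1' x; have h2 := step X2 X2' X1; have h3 := step X3 X3' X2.
have {}h1 := h1 (fun v => _); have {}h2 := h2 (fun v => _); have {}h3 := h3 (fun v => _).
set A1 := (1 - c) * maxdot N X1 + _ in h1.
set A2 := (1 - c) * maxdot N X2 + _ in h2.
set A3 := (1 - c) * maxdot N X3 + _ in h3.
have hs : maxdot N y - maxdot N x <= A1 + A2 + A3.
  rewrite -{1}(lcomb01 x y) -/X3.
  have {}h1 : maxdot N X1 - maxdot N x <= A1.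
    apply: h1 => v; rewrite !dott_lcomb.
    transitivity ((c * c + s * s) * dott v x); first by rewrite s2 c2; field.
    by ring.
  have {}h2 : maxdot N X2 - maxdot N X1 <= A2.
    apply: h2 => v; rewrite !dott_lcomb.
    transitivity (c * (s + s) * dott v x + (c * c - s * s) * dott v y); last by ring.
    by rewrite s2 c2 sE; field.
  have {}h3 : maxdot N X3 - maxdot N X2 <= A3.
    by apply: h3 => v; rewrite !dott_lcomb; ring.
  lra.
apply: (@le_trans _ _ (expR (th * A1) * expR (th * A2) * expR (th * A3))).
  by rewrite -!expRD ler_expR -!mulrDr ler_wpM2l.
apply: le_trans (amgm3 _ _ _) _; rewrite ?expR_ge0//.
rewrite /rotation_bound /= -/A1 -/A2 -/A3 -!expRM_natl.
by rewrite !mulrA.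
Qed.

Local Open Scope ereal_scope.

Let integral_cst_prob (r : R) : \int[G]_x r%:E = r%:E.
Proof.
rewrite integral_cst//; transitivity (r%:E * 1); last by rewrite mule1.
by congr (_ * _); exact: (probability_setT G).
Qed.

(** The maximising form is zero or some [w k], so the exponential is at most one plus the sum of all
    of theirs. Finiteness matters because [maxdot_mgf] bounds the moment in terms of itself. *)
Lemma maxdot_mgf_fin N (th : R) : \int[G]_x (expR (th * maxdot N x))%:E < +oo.
Proof.
pose h (x : n.-tuple RR) := (1 + \sum_(k < N) expR (dott (fun i => th * w k i) x))%R.
have dE k x : dott (fun i => th * w k i)%R x = (th * dott (w k) x)%R.
  by rewrite /dott mulr_sumr; apply: eq_bigr => i _; rewrite mulrA.
have me k : measurable_fun setT (fun x : n.-tuple RR => (expR (dott (fun i => th * w k i)%R x))).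
  by apply: measurableT_comp => //; exact: measurable_dott.
have mf : measurable_fun setT (fun x => (expR (th * maxdot N x))%:E).
  apply/measurable_EFinP; apply: measurableT_comp => //; apply: measurable_funM => //.
  exact: measurable_maxdot.
have mh : measurable_fun setT (fun x => (h x)%:E).
  by apply/measurable_EFinP; apply: measurable_funD => //; apply: measurable_sum => k.
apply: (@le_lt_trans _ _ (\int[G]_x (h x)%:E)).
  apply: ge0_le_integral => //= x _.
  rewrite lee_fin /maxdot; apply: (best_ind (P := fun v => expR (th * dott v x) <= h x)%R).
    by rewrite dott0 mulr0 expR0 /h lerDl sumr_ge0// => k _; rewrite expR_ge0.
  move=> k kN; rewrite /h (bigD1 (Ordinal kN))//= dE.
  have : (0 <= \sum_(i < N | i != Ordinal kN) expR (dott (fun j => th * w i j) x))%R.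
    by rewrite sumr_ge0// => j _; rewrite expR_ge0.
  lra.
rewrite /h; under eq_integral do rewrite EFinD -sumEFin.
rewrite ge0_integralD//; last 2 first.
- by move=> x _; rewrite sume_ge0// => k _; rewrite lee_fin expR_ge0.
- by apply: emeasurable_sum => k; apply/measurable_EFinP.
rewrite ge0_integral_sum//; last first.
- by move=> k; apply/measurable_EFinP.
rewrite (integral_cst_prob 1).
under eq_bigr do rewrite gauss_mgf//.
by rewrite sumEFin -EFinD ltry.
Qed.

(** Let m be the moment and M the maximum. For independent x and y, the mean of exp(th (M(y) -
    M(x))) is at least m q exp(- th med), and by rotation invariance at most K times the moment at
    th/2. The latter is at most (a m + 1/a)/2. Taking K a = q exp(- th med) leaves a^2 m <= 1, and
    this square is what doubles the median. *)
Lemma maxdot_mgf N (th L2 med q : R) : (0 <= th)%R -> (0 < q)%R ->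
  (forall k, (k < N)%N -> \sum_(i < n) w k i ^+ 2 <= L2)%R -> (0 <= L2)%R ->
  q%:E <= G [set x | (maxdot N x <= med)%R] ->
  \int[G]_x (expR (th * maxdot N x))%:E <=
  (expR (2 * th * med + 9 / 4 * th ^+ 2 * sigma ^+ 2 * L2) / q ^+ 2)%:E.
Proof.
move=> th0 q0 wL L20 hmed.
have [s sE] : exists s : R, s = (2^-1)%R by exists (2^-1)%R.
have [c cE cge0] : exists2 c : R, (c ^+ 2 = 3 / 4)%R & (0 <= c)%R.
  by exists (Num.sqrt (3 / 4)); rewrite ?sqr_sqrtr ?divr_ge0 ?sqrtr_ge0.
(* Hence [3 * (1 - c) <= 1 / 2]: the second-order error uses at most half of the exponential
   parameter. This is where steps of pi/6 are short enough. *)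
have c_ge : (5 / 6 <= c)%R.
  rewrite -(@ler_pXn2r _ 2)// ?nnegrE ?divr_ge0// cE; lra.
have s0 : (s != 0)%R by rewrite sE invr_eq0.
have c0 : (c != 0)%R by rewrite gt_eqF// (lt_le_trans _ c_ge).
have cs : (c ^+ 2 + s ^+ 2 = 1)%R by rewrite cE sE; field.
have mexp (a : R) : measurable_fun setT (fun x => (expR (a * maxdot N x))%:E).
  apply/measurable_EFinP; apply: measurableT_comp => //; apply: measurable_funM => //.
  exact: measurable_maxdot.
have md : measurable_fun setT (fun z : n.-tuple RR * n.-tuple RR =>
    (expR (th * (maxdot N z.2 - maxdot N z.1)))%:E).
  apply/measurable_EFinP; apply: measurableT_comp => //; apply: measurable_funM => //.
  apply: measurable_funB.
    exact: (measurableT_comp (measurable_maxdot N) measurable_snd).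
  exact: (measurableT_comp (measurable_maxdot N) measurable_fst).
pose Psi z := (rotation_bound N th c s z)%:E.
have Psi0 z : 0 <= Psi z by rewrite lee_fin expR_ge0.
have mPsi : measurable_fun setT Psi.
  apply/measurable_EFinP; apply: measurableT_comp => //; apply: measurable_funM => //.
  apply: measurable_funD; apply: measurable_funM => //.
    exact: (measurableT_comp (measurable_maxdot N) measurable_fst).
  apply: measurable_dott => // i.
  exact: (measurableT_comp (measurable_best N i) measurable_fst).
pose K := expR (9 / 8 * th ^+ 2 * sigma ^+ 2 * L2).
(* For [x] fixed the selected form is fixed too, and integrating over [y] is a Gaussian moment
   generating function; [s = 1 / 2] and the bound [L2] on squared norms give [K]. *)
have IPsi : \int[G]_x \int[G]_y Psi (x, y) <= K%:E * \int[G]_x (expR (th / 2 * maxdot N x))%:E.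
  rewrite -ge0_integralZl//; last first.
    by rewrite lee_fin expR_ge0.
  apply: ge0_le_integral => //=.
  - by move=> x _; apply: integral_ge0.
  - exact: (measurable_fun_fubini_tonelli_F Psi).
  - exact: emeasurable_funM.
  move=> x _.
  have PE y : Psi (x, y) = (expR (3 * th * (1 - c) * maxdot N x))%:E *
     (expR (dott (fun i => 3 * th * s * best N x i)%R y))%:E.
    rewrite -EFinM -expRD; congr (expR _)%:E => /=.
    have -> : (dott (fun i => 3 * th * s * best N x i) y = 3 * th * s * dott (best N x) y)%R.
      by rewrite /dott mulr_sumr; apply: eq_bigr => i _; rewrite mulrA.
    by ring.
  under eq_integral do rewrite PE.
  rewrite ge0_integralZl//; last first.
    by apply/measurable_EFinP; apply: measurableT_comp => //; exact: measurable_dott.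
  rewrite gauss_mgf// -!EFinM lee_fin mulrC.
  apply: ler_pM; rewrite ?expR_ge0// ler_expR.
    rewrite [leLHS](_ : _ = 9 / 8 * th ^+ 2 * sigma ^+ 2 * \sum_(i < n) best N x i ^+ 2)%R; last first.
      rewrite !mulr_sumr; by apply: eq_bigr => i _; rewrite sE; field.
    rewrite ler_wpM2l ?mulr_ge0 ?(ltW sigma_gt0)//.
    apply: (best_ind (P := fun v => \sum_(i < n) v i ^+ 2 <= L2)%R) => //.
    by rewrite big1// => i _; rewrite expr0n.
  rewrite ler_wpM2r ?maxdot_ge0//.
  have : (0 <= th * (c - 5 / 6))%R by rewrite mulr_ge0 ?subr_ge0.
  lra.
have upper : \int[G]_x \int[G]_y (expR (th * (maxdot N y - maxdot N x)))%:E <=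
    \int[G]_x \int[G]_y Psi (x, y).
  pose F1 z := Psi (lcomb c s z.1 z.2, lcomb (- s) c z.1 z.2).
  pose F2 z := Psi (lcomb s c z.1 z.2, lcomb (- c) s z.1 z.2).
  pose F3 z := Psi (lcomb 0 1 z.1 z.2, lcomb (- 1) 0 z.1 z.2).
  have mF a b a' b' : measurable_fun setT (fun z => Psi (lcomb a b z.1 z.2, lcomb a' b' z.1 z.2)).
    by apply: measurableT_comp => //; apply: measurable_fun_pair; exact: measurable_lcomb.
  have e1 : \int[G]_x \int[G]_y F1 (x, y) = \int[G]_x \int[G]_y Psi (x, y).
    exact: (gauss_rotation sigma_gt0 cs s0 mPsi Psi0).
  have e2 : \int[G]_x \int[G]_y F2 (x, y) = \int[G]_x \int[G]_y Psi (x, y).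
    have sc : (s ^+ 2 + c ^+ 2 = 1)%R by rewrite addrC.
    exact: (gauss_rotation sigma_gt0 sc c0 mPsi Psi0).
  have e3 : \int[G]_x \int[G]_y F3 (x, y) = \int[G]_x \int[G]_y Psi (x, y).
    have zo : (0 ^+ 2 + 1 ^+ 2 = 1 :> R)%R by rewrite expr0n add0r expr1n.
    exact: (gauss_rotation sigma_gt0 zo (oner_neq0 R) mPsi Psi0).
  have F10 z : 0 <= F1 z by exact: Psi0.
  have F20 z : 0 <= F2 z by exact: Psi0.
  have F30 z : 0 <= F3 z by exact: Psi0.
  have mF1 : measurable_fun setT F1 by exact: mF.
  have mF2 : measurable_fun setT F2 by exact: mF.
  have mF3 : measurable_fun setT F3 by exact: mF.
  pose D z := (expR (th * (maxdot N z.2 - maxdot N z.1)))%:E.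
  have D0 z : 0 <= D z by rewrite lee_fin expR_ge0.
  have mD : measurable_fun setT D by exact: md.
  have DF z : D z <= 3^-1%:E * (F1 z + F2 z + F3 z).
    rewrite /D /F1 /F2 /F3 /Psi -!EFinD -EFinM lee_fin [leRHS]mulrC.
    exact: (maxdot_rotation N z.1 z.2 th0 sE cE).
  change (\int[G]_x \int[G]_y D (x, y) <= \int[G]_x \int[G]_y Psi (x, y)).
  clearbody D F1 F2 F3; clear mF IPsi md.
  have F120 z : 0 <= F1 z + F2 z by rewrite adde_ge0.
  have mF12 : measurable_fun setT (fun z => F1 z + F2 z) by exact: emeasurable_funD.
  have F1230 z : 0 <= F1 z + F2 z + F3 z by rewrite adde_ge0.
  have mF123 : measurable_fun setT (fun z => F1 z + F2 z + F3 z) by exact: emeasurable_funD.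
  have I3 : \int[G \x G]_z (F1 z + F2 z + F3 z) =
      \int[G]_x \int[G]_y F1 (x, y) + \int[G]_x \int[G]_y F2 (x, y) +
      \int[G]_x \int[G]_y F3 (x, y).
    rewrite ge0_integralD// ge0_integralD//.
    by rewrite (fubini_tonelli1 F1)// (fubini_tonelli1 F2)// (fubini_tonelli1 F3).
  rewrite e1 e2 e3 in I3.
  rewrite -(fubini_tonelli1 D)//.
  apply: (@le_trans _ _ (\int[G \x G]_z (3^-1%:E * (F1 z + F2 z + F3 z)))).
    by apply: ge0_le_integral => //=; exact: emeasurable_funM.
  rewrite ge0_integralZl// I3.
  set I := \int[G]_x _; have : 0 <= I by apply: integral_ge0 => x _; apply: integral_ge0.
  case: I => [r| |] // r0; last by rewrite !addye// mulry gtr0_sg// mul1e.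
  by rewrite -!EFinD -EFinM lee_fin; lra.
have lower : \int[G]_x (expR (th * maxdot N x))%:E * (q * expR (- (th * med)))%:E <=
    \int[G]_x \int[G]_y (expR (th * (maxdot N y - maxdot N x)))%:E.
  have -> : \int[G]_x \int[G]_y (expR (th * (maxdot N y - maxdot N x)))%:E =
     \int[G]_x ((expR (- th * maxdot N x))%:E * \int[G]_y (expR (th * maxdot N y))%:E).
    apply: eq_integral => x _; rewrite -ge0_integralZl//.
    by apply: eq_integral => y _; rewrite -EFinM -expRD; congr (expR _)%:E; ring.
  rewrite ge0_integralZr//; last by apply: integral_ge0.
  rewrite muleC; apply: lee_wpmul2r; first exact: integral_ge0.
  have mA : measurable [set x | (maxdot N x <= med)%R].
    by apply: measurable_set_le => //; exact: measurable_maxdot.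
  apply: (@le_trans _ _ (\int[G]_(x in [set x | (maxdot N x <= med)%R]) (expR (- (th * med)))%:E)).
    rewrite integral_cst// EFinM muleC; exact: lee_wpmul2l.
  apply: (@le_trans _ _ (\int[G]_(x in [set x | (maxdot N x <= med)%R]) (expR (- th * maxdot N x))%:E)).
    apply: ge0_le_integral => //=.
    - exact: measurable_funTS.
    - by move=> x xm; rewrite lee_fin ler_expR mulNr lerN2 ler_wpM2l.
  exact: ge0_subset_integral.
have mfin := maxdot_mgf_fin N th.
have : 0 <= \int[G]_x (expR (th * maxdot N x))%:E by apply: integral_ge0.
have := le_trans lower (le_trans upper IPsi).
(* With this weight [K * a] is the factor of the moment in [lower], so half of that side absorbs the
   moment reappearing on the right. *)
pose a := (q * expR (- (th * med)) / K)%R.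
have a0 : (0 < a)%R by rewrite divr_gt0 ?mulr_gt0 ?expR_gt0.
have half : \int[G]_x (expR (th / 2 * maxdot N x))%:E <=
   (a / 2)%:E * \int[G]_x (expR (th * maxdot N x))%:E + (a^-1 / 2)%:E.
  rewrite -ge0_integralZl//; last by rewrite lee_fin divr_ge0// ltW.
  rewrite -(integral_cst_prob (a^-1 / 2)%R) -ge0_integralD//; first last.
  - by move=> x _; rewrite lee_fin divr_ge0// ltW// invr_gt0.
  - exact: emeasurable_funM.
  - by move=> x _; rewrite mule_ge0// lee_fin divr_ge0// ltW.
  apply: ge0_le_integral => //=.
  - by apply: emeasurable_funD => //; exact: emeasurable_funM.
  move=> x _; rewrite -EFinM -EFinD lee_fin.
  set e := expR (th / 2 * maxdot N x).
  have -> : (expR (th * maxdot N x) = e ^+ 2)%R.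
    by rewrite /e -expRM_natl; congr expR; field.
  rewrite -(ler_pM2r a0) -subr_ge0.
  rewrite (_ : _ - _ = (a * e - 1) ^+ 2 / 2)%R ?divr_ge0 ?sqr_ge0//.
  by field; rewrite gt_eqF.
move: half mfin; case: (\int[G]_x (expR (th * maxdot N x))%:E) => [m| |]// half _.
move=> h _; have {}h := le_trans h (lee_wpmul2l _ half).
have {}h : m%:E * (q * expR (- (th * med)))%:E <= K%:E * ((a / 2)%:E * m%:E + (a^-1 / 2)%:E).
  by apply: h; rewrite lee_fin expR_ge0.
rewrite lee_fin.
have {}h : (m * (q * expR (- (th * med))) <= K * (a / 2 * m + a^-1 / 2))%R.
  by rewrite -lee_fin.
have K0 : (0 < K)%R by exact: expR_gt0.
have aE : (K * a = q * expR (- (th * med)))%R by rewrite /a mulrC divfK// gt_eqF.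
rewrite -aE in h.
have {}h : (a ^+ 2 * m <= 1)%R.
  have h2 := ler_wpM2r (ltW a0) h.
  have e : (K * (a / 2 * m + a^-1 / 2) * a = K * (a ^+ 2 * m) / 2 + K / 2)%R.
    by field; rewrite gt_eqF.
  rewrite e in h2.
  have : (K * (a ^+ 2 * m) <= K * 1)%R by nra.
  by rewrite ler_pM2l.
have a20 : (0 < a ^+ 2)%R by rewrite exprn_gt0.
rewrite -(ler_pM2l a20) (le_trans h)//.
rewrite /a !exprMn exprVn -/K.
have -> : (expR (2 * th * med + 9 / 4 * th ^+ 2 * sigma ^+ 2 * L2) = expR (th * med) ^+ 2 * K ^+ 2)%R.
  by rewrite /K -!expRM_natl -expRD; congr expR; field.
rewrite expRN; set e := expR (th * med).
have e0 : (0 < e)%R by exact: expR_gt0.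
by rewrite le_eqVlt; apply/orP; left; apply/eqP; field; rewrite !gt_eqF.
Qed.

Lemma maxdot_tail N (th L2 med q : R) : (0 <= th)%R -> (0 < q)%R ->
  (forall k, (k < N)%N -> \sum_(i < n) w k i ^+ 2 <= L2)%R -> (0 <= L2)%R ->
  q%:E <= G [set x | (maxdot N x <= med)%R] ->
  G [set x | (1 < maxdot N x)%R] <=
  (expR (2 * th * med + 9 / 4 * th ^+ 2 * sigma ^+ 2 * L2 - th) / q ^+ 2)%:E.
Proof.
move=> th0 q0 wL L20 hmed.
have mA : measurable [set x | (1 < maxdot N x)%R].
  by apply: measurable_set_lt => //; exact: measurable_maxdot.
have mexp : measurable_fun setT (fun x => (expR (th * maxdot N x))%:E).
  apply/measurable_EFinP; apply: measurableT_comp => //; apply: measurable_funM => //.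
  exact: measurable_maxdot.
have h := maxdot_mgf th0 q0 wL L20 hmed.
apply: (@le_trans _ _ ((expR (- th))%:E * \int[G]_x (expR (th * maxdot N x))%:E)).
  rewrite -[X in X <= _]mul1e -(integral_cst G)// -ge0_integralZl//.
  apply: (@le_trans _ _ (\int[G]_(x in [set x | (1 < maxdot N x)%R]) ((expR (- th))%:E * (expR (th * maxdot N x))%:E))).
    apply: ge0_le_integral => //=.
    - by apply: measurable_funTS; exact: emeasurable_funM.
    move=> x xm; rewrite -EFinM lee_fin -expRD -expR0 ler_expR.
    have : (0 <= th * (maxdot N x - 1))%R by rewrite mulr_ge0// subr_ge0 ltW.
    lra.
  by apply: ge0_subset_integral => //; exact: emeasurable_funM.
apply: (le_trans (lee_wpmul2l _ h)); first by rewrite lee_fin expR_ge0.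
by rewrite -EFinM lee_fin mulrA -expRD (addrC (- th)%R).
Qed.

End gauss_concentration.

(** * The sorted l1 norm *)

Section sorted_l1.
Context {R : realType} {m : nat}.
Implicit Types (u v : 'cV[R]_m) (lam : nat -> R).

Let geR (a b : R) := b <= a.
Let geR_total : total geR. Proof. by move=> x y; exact: le_total. Qed.
Let geR_trans : transitive geR. Proof. by move=> x y z /[swap]; exact: le_trans. Qed.
Let geR_anti : antisymmetric geR.
Proof. by move=> x y; rewrite andbC => /le_anti. Qed.

Lemma l0E u : l0 u = size [seq i <- enum 'I_m | u i 0 != 0].
Proof.
rewrite /l0 cardE enumT /enum_mem; congr size; apply: eq_filter => i.
by apply/idP/idP => [/set_mem|/mem_set].
Qed.

Lemma card_ord_lt l : (l <= m)%N -> #|[set j : 'I_m | (j < l)%N]%SET| = l.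
Proof.
move=> lm; rewrite -sum1dep_card (eq_bigl (fun j : 'I_m => (j < l)%N))//.
by rewrite -(big_ord_widen m (fun=> 1%N) lm) sum1_card card_ord.
Qed.

Lemma arrangement_perm (a : seq R) u :
  perm_eq a [seq `|u i 0| | i <- enum 'I_m] ->
  exists p : {perm 'I_m}, forall j : 'I_m, nth 0 a j = `|u (p j) 0|.
Proof.
pose t : m.-tuple R := [tuple (`|u i 0| : R) | i < m].
have -> : [seq `|u i 0| | i <- enum 'I_m] = t by [].
move=> /tuple_permP[p ->]; exists p => j.
by rewrite -tnth_nth !tnth_mktuple.
Qed.

Lemma sorted_abs_perm u :
  exists p : {perm 'I_m}, forall j : 'I_m, sorted_abs u j = `|u (p j) 0|.
Proof. by apply: arrangement_perm; rewrite perm_sort. Qed.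

Lemma sorted_abs_ge0 u j : 0 <= sorted_abs u j.
Proof.
have [jm|jm] := ltnP j m.
  by have [p /(_ (Ordinal jm)) /= ->] := sorted_abs_perm u.
by rewrite /sorted_abs nth_default// size_sort size_map size_enum_ord.
Qed.

Lemma sorted_abs_le u i j : (i <= j)%N -> (j < m)%N -> sorted_abs u j <= sorted_abs u i.
Proof.
move=> ij jm.
have sz : size (sort geR [seq `|u i 0| | i <- enum 'I_m]) = m.
  by rewrite size_sort size_map size_enum_ord.
apply: (@sorted_leq_nth _ geR geR_trans _ 0); rewrite ?inE ?sz//.
- by move=> x; exact: lexx.
- exact: sort_sorted.
- exact: leq_ltn_trans jm.
Qed.

(** Summation by parts: with nonincreasing nonnegative [c], only partial sums need to be
    compared. *)
Lemma sum_mul_le_abel (a b c : nat -> R) l :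
  (forall i j, (i <= j < l)%N -> c j <= c i) -> (forall i, 0 <= c i) ->
  (forall q, (q <= l)%N -> \sum_(j < q) a j <= \sum_(j < q) b j) ->
  \sum_(j < l) a j * c j <= \sum_(j < l) b j * c j.
Proof.
move=> cd c0 ab; rewrite -subr_ge0 -sumrB.
case: l => [|l] in cd ab *; first by rewrite big_ord0.
apply: (@le_trans _ _ ((\sum_(j < l.+1) (b j - a j)) * c l)).
  by rewrite mulr_ge0// sumrB subr_ge0 ab.
elim: l => [|l IH] in cd ab *; first by rewrite !big_ord1 mulrBl.
rewrite big_ord_recr [leRHS]big_ord_recr/= mulrDl mulrBl lerD2r.
apply: le_trans (IH _ _); first last.
- by move=> q ql; rewrite ab// ltnW.
- by move=> i j /andP[ij jl]; rewrite cd// ij ltnW.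
by rewrite ler_wpM2l ?cd ?leqnSn//= sumrB subr_ge0 ab.
Qed.

(** Elements are removed from [S] one at a time, each time one that meets the bound for the current
    cardinality. *)
Lemma sum_subset_le (h : 'I_m -> R) (b : nat -> R) :
  (forall S : {set 'I_m}, (0 < #|S|)%N -> exists2 i, i \in S & h i <= b #|S|.-1) ->
  forall S : {set 'I_m}, \sum_(i in S) h i <= \sum_(j < #|S|) b j.
Proof.
move=> hb S; move eq_n : #|S| => n.
elim: n S eq_n => [|n IH] S cS.
  by rewrite (cards0_eq cS) big_set0 big_ord0.
have [i iS hi] : exists2 i, i \in S & h i <= b #|S|.-1 by apply: hb; rewrite cS.
rewrite (big_setD1 i)//= big_ord_recr addrC lerD//; last by rewrite cS in hi.
by apply: IH; move: cS; rewrite (cardsD1 i) iS => -[].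
Qed.

(* The hypothesis says that the sorted values of h lie below b. *)
Lemma sum_abs_le_sorted (h : 'I_m -> R) (b : nat -> R) u :
  (forall S : {set 'I_m}, (0 < #|S|)%N -> exists2 i, i \in S & h i <= b #|S|.-1) ->
  \sum_(i < m) h i * `|u i 0| <= \sum_(j < m) b j * sorted_abs u j.
Proof.
move=> hb; have [p pE] := sorted_abs_perm u.
rewrite (reindex_inj (@perm_inj _ p))/=.
pose a j := oapp (fun i => h (p i)) 0 (insub j : option 'I_m).
have aE (j : 'I_m) : a j = h (p j) by rewrite /a valK.
under eq_bigr do rewrite -pE -aE.
apply: sum_mul_le_abel.
- by move=> i j /andP[ij jm]; exact: sorted_abs_le.
- by move=> i; exact: sorted_abs_ge0.
move=> q qm; rewrite (big_ord_widen m a qm).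
have cq : #|[set p j | j in [set j : 'I_m | (j < q)%N]%SET]%SET| = q.
  by rewrite card_imset ?card_ord_lt//; exact: perm_inj.
rewrite -[in leRHS]cq; apply: le_trans (sum_subset_le hb _).
rewrite big_imset/=; last by move=> ? ? _ _; exact: perm_inj.
rewrite le_eqVlt; apply/orP; left; apply/eqP.
by apply: eq_big => [j|j _]; rewrite ?inE ?aE.
Qed.

(** Pigeonhole: an injective [p] cannot send all of [S] strictly below [#|S|.-1]. *)
Lemma exists_perm_ge (p : {perm 'I_m}) (S : {set 'I_m}) : (0 < #|S|)%N ->
  exists2 i, i \in S & (#|S|.-1 <= p i)%N.
Proof.
move=> S0; apply: contrapT => h.
have sub : p @: S \subset [set j : 'I_m | (j < #|S|.-1)%N]%SET.
  apply/fintype.subsetP => _ /imsetP[i iS ->]; rewrite inE ltnNge; apply/negP => pi.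
  by apply: h; exists i.
have Sm : (#|S|.-1 <= m)%N.
  by rewrite (leq_trans (leq_pred _))// (leq_trans (max_card _))// card_ord.
have := subset_leq_card sub; rewrite card_imset; last exact: perm_inj.
by rewrite card_ord_lt// -ltnS prednK// ltnn.
Qed.

Variable lam : nat -> R.
Hypothesis lam_ge0 : forall j, 0 <= lam j.
Hypothesis lam_ninc : forall i j, (0 < i <= j)%N -> lam j <= lam i.

(** The rearrangement inequality. With [Jsl_perm] it makes [Jsl] a maximum of weighted l1 norms over
    permutations, whence subadditivity. *)
Lemma perm_le_Jsl (p : {perm 'I_m}) u :
  \sum_(i < m) lam (p i).+1 * `|u i 0| <= Jsl lam u.
Proof.
apply: (sum_abs_le_sorted (b := fun j => lam j.+1)) => S S0.
have [i iS pi] := exists_perm_ge p S0.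
by exists i => //; apply: lam_ninc.
Qed.

Lemma Jsl_perm u : exists p : {perm 'I_m}, Jsl lam u = \sum_(i < m) lam (p i).+1 * `|u i 0|.
Proof.
have [p pE] := sorted_abs_perm u; exists (p^-1)%g.
rewrite [RHS](reindex_inj (@perm_inj _ p))/=.
by apply: eq_bigr => i _; rewrite permK pE.
Qed.

Lemma arrangement_le_Jsl (a : seq R) u :
  perm_eq a [seq `|u i 0| | i <- enum 'I_m] ->
  \sum_(j < m) lam j.+1 * nth 0 a j <= Jsl lam u.
Proof.
move=> /arrangement_perm[p pE]; apply: le_trans (perm_le_Jsl p^-1%g u).
rewrite [leRHS](reindex_inj (@perm_inj _ p))/= le_eqVlt; apply/orP; left; apply/eqP.
by apply: eq_bigr => i _; rewrite permK pE.
Qed.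

Lemma Jsl_ge0 u : 0 <= Jsl lam u.
Proof. by rewrite sumr_ge0// => j _; rewrite mulr_ge0// sorted_abs_ge0. Qed.

Lemma Jsl_triangle u v : Jsl lam (u + v) <= Jsl lam u + Jsl lam v.
Proof.
have [p ->] := Jsl_perm (u + v).
apply: le_trans (lerD (perm_le_Jsl p u) (perm_le_Jsl p v)).
rewrite -big_split/=; apply: ler_sum => i _.
by rewrite -mulrDr ler_wpM2l// mxE ler_normD.
Qed.

Lemma Jsl_scale t u : 0 <= t -> Jsl lam (t *: u) <= t * Jsl lam u.
Proof.
move=> t0; have [p ->] := Jsl_perm (t *: u).
apply: le_trans (ler_wpM2l t0 (perm_le_Jsl p u)).
rewrite mulr_sumr; apply: ler_sum => i _.
by rewrite mxE normrM (ger0_norm t0) mulrCA.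
Qed.

Lemma Jsl_le_l1 u : Jsl lam u <= lam 1%N * \sum_(i < m) `|u i 0|.
Proof.
have [p ->] := Jsl_perm u; rewrite mulr_sumr; apply: ler_sum => i _.
by rewrite ler_wpM2r// lam_ninc.
Qed.

Lemma sum_sqr_sorted_abs u : \sum_(j < m) sorted_abs u j ^+ 2 = sqn u.
Proof.
have [p pE] := sorted_abs_perm u.
rewrite /sqn [RHS](reindex_inj (@perm_inj _ p))/=.
by apply: eq_bigr => i _; rewrite pE real_normK// num_real.
Qed.

(** Ranks become counts, so two sorted lists can be compared without describing how they interleave:
    deleting entries lowers a count by at most their number. *)
Lemma count_gt_sorted (t : R) (s : seq R) j : sorted geR s -> (j < size s)%N ->
  (t < nth 0 s j) = (j < count (fun x => t < x)%R s)%N.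
Proof.
move=> ss js; apply/idP/idP => h.
  rewrite -(cat_take_drop j.+1 s) count_cat.
  apply: (@leq_trans (count (fun x => t < x)%R (take j.+1 s))); last exact: leq_addr.
  have szt : size (take j.+1 s) = j.+1 by rewrite size_takel.
  suff /eqP -> : count (fun x => t < x)%R (take j.+1 s) == size (take j.+1 s) by rewrite szt.
  rewrite -all_count; apply/allP => x /(nthP 0)[i].
  rewrite szt ltnS => ij <-; rewrite nth_take ?ltnS//.
  apply: lt_le_trans h _; apply: (@sorted_leq_nth _ geR geR_trans _ 0) => //.
  - by move=> y; exact: lexx.
  - by rewrite inE (leq_ltn_trans ij).
rewrite ltNge; apply/negP => h'.
move: h; rewrite ltnNge => /negP; apply.
rewrite -(cat_take_drop j s) count_cat.
have -> : count (fun x => t < x)%R (drop j s) = 0%N.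
  apply/eqP; rewrite -leqn0 leqNgt -has_count; apply/negP => /hasP[x /(nthP 0)[i]].
  rewrite size_drop => ij <-; rewrite nth_drop => tx.
  suff : nth 0 s (j + i)%N <= nth 0 s j by move=> /(lt_le_trans tx); rewrite ltNge h'.
  apply: (@sorted_leq_nth _ geR geR_trans _ 0) => //; rewrite ?inE ?leq_addr//.
  - by move=> y; exact: lexx.
  - by rewrite -ltn_subRL.
rewrite addn0; apply: leq_trans (count_size _ _) _.
by rewrite size_take; case: ifP => // /negbT; rewrite -leqNgt.
Qed.

(** Whatever the permutation, weights set to zero off [S] lie, once sorted, below the first [k]
    entries of [lam] followed by zeros. *)
Lemma Jsl_masked_le (S : {set 'I_m}) k u : (#|S| <= k <= m)%N ->
  (forall i, i \notin S -> u i 0 = 0) ->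
  forall v, (forall i, `|u i 0| <= `|v i 0|) ->
  Jsl lam u <= \sum_(j < k) lam j.+1 * sorted_abs v j.
Proof.
move=> /andP[Sk km] u0 v uv.
have [p ->] := Jsl_perm u.
pose h i := if i \in S then lam (p i).+1 else 0.
pose b j := if (j < k)%N then lam j.+1 else 0.
apply: (@le_trans _ _ (\sum_(i < m) h i * `|v i 0|)).
  apply: ler_sum => i _; rewrite /h; case: ifPn => iS; first by rewrite ler_wpM2l.
  by rewrite u0// normr0 mulr0 mul0r.
apply: le_trans (sum_abs_le_sorted (b := b) v _) _.
  move=> A A0; rewrite /b; case: ltnP => kA.
    have [i iA pi] := exists_perm_ge p A0; exists i => //.
    by rewrite /h; case: ifP => _ //; apply: lam_ninc.
  have /fintype.subsetPn[i iA iS] : ~~ (A \subset S).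
    apply/negP => /subset_leq_card AS.
    by have := leq_trans AS (leq_trans Sk kA); rewrite -ltnS prednK// ltnn.
  by exists i => //; rewrite /h (negbTE iS).
rewrite [leRHS](big_ord_widen m (fun j => lam j.+1 * sorted_abs v j))//= [leRHS]big_mkcond/=.
by apply: ler_sum => i _; rewrite /b; case: ifP => //; rewrite mul0r.
Qed.

(** Listing the sorted nonzero entries of [b], then the sorted entries of [u] off the support of
    [b], is one arrangement of [z], so it bounds [Jsl lam z] from below. Past the support of [b],
    position [j] carries at least the [j]-th sorted entry of [u]; contributions of [u] at positions
    below [k] are given up. *)
Lemma Jsl_disjoint_ge (k : nat) (b z u : 'cV[R]_m) : (l0 b <= k <= m)%N ->
  (forall i, z i 0 = if b i 0 != 0 then b i 0 else u i 0) ->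
  Jsl lam b + (Jsl lam u - \sum_(j < k) lam j.+1 * sorted_abs u j) <= Jsl lam z.
Proof.
move=> /andP[bk km] zE.
pose eS := [seq i <- enum 'I_m | b i 0 != 0].
pose eC := [seq i <- enum 'I_m | ~~ (b i 0 != 0)].
pose sb := sort geR [seq `|b i 0| | i <- eS].
pose sc := sort geR [seq `|u i 0| | i <- eC].
have szS : size eS = l0 b by rewrite l0E.
have szSC : (size eS + size eC = m)%N.
  by rewrite !size_filter -[RHS](size_enum_ord m) count_predC.
have szsb : size sb = size eS by rewrite size_sort size_map.
have szsc : size sc = size eC by rewrite size_sort size_map.
have permE (f : 'I_m -> R) : perm_eq ([seq f i | i <- eS] ++ [seq f i | i <- eC]) [seq f i | i <- enum 'I_m].
  by rewrite -map_cat perm_map// perm_filterC.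
have pz : perm_eq (sb ++ sc) [seq `|z i 0| | i <- enum 'I_m].
  apply: perm_trans (permE (fun i => `|z i 0|)).
  apply: perm_cat; rewrite perm_sort.
  - rewrite (_ : [seq `|b i 0| | i <- eS] = [seq `|z i 0| | i <- eS])//.
    by apply/eq_in_map => i; rewrite mem_filter => /andP[bi _]; rewrite zE bi.
  - rewrite (_ : [seq `|u i 0| | i <- eC] = [seq `|z i 0| | i <- eC])//.
    by apply/eq_in_map => i; rewrite mem_filter => /andP[bi _]; rewrite zE (negbTE bi).
have pb : sort geR [seq `|b i 0| | i <- enum 'I_m] = sb ++ nseq (size eC) 0.
  apply: (sorted_eq geR_trans geR_anti); first exact: sort_sorted.
    rewrite (sorted_pairwise geR_trans) pairwise_cat; apply/and3P; split.
    - apply/allrelP => x y xs /nseqP[-> _]; move: xs; rewrite mem_sort => /mapP[i _ ->].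
      exact: normr_ge0.
    - by rewrite -(sorted_pairwise geR_trans); exact: sort_sorted.
    - elim: (size eC) => //= q IHq; rewrite IHq andbT.
      by apply/allP => x /nseqP[-> _]; exact: lexx.
  rewrite perm_sort perm_sym; apply: perm_trans (permE (fun i => `|b i 0|)).
  apply: perm_cat; first by rewrite perm_sort.
  rewrite (_ : nseq _ _ = [seq `|b i 0| | i <- eC])//; apply/esym.
  rewrite -(size_map (fun i => `|b i 0|)); apply/all_pred1P/allP => x /mapP[i].
  by rewrite mem_filter negbK => /andP[/eqP bi _] ->; rewrite /= bi normr0.
apply: le_trans (arrangement_le_Jsl pz).
rewrite /Jsl {1}/sorted_abs -/geR pb.
rewrite (big_ord_widen m (fun j => lam j.+1 * sorted_abs u j) km) [X in _ + (_ - X)]big_mkcond/=.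
rewrite -sumrB -big_split/=; apply: ler_sum => j _.
have jm := ltn_ord j.
rewrite !nth_cat szsb; case: ltnP => jS.
  have -> : (j < k)%N by rewrite (leq_trans jS)// szS.
  by rewrite subrr addr0.
have jC : (j - size eS < size eC)%N by rewrite ltn_subLR// szSC.
rewrite nth_nseq jC mulr0 add0r.
have sc0 : 0 <= nth 0 sc (j - size eS).
  have : nth 0 sc (j - size eS) \in sc by rewrite mem_nth// szsc.
  by rewrite mem_sort => /mapP[i _ ->].
case: ifP => jk; first by rewrite subrr mulr_ge0.
(* Otherwise more than [j] entries of [u] exceed this one. At most [size eS] of them sit on the
   support of [b], so more than [j - size eS] are in [sc], and the entry of that rank would exceed
   itself. *)
rewrite subr0 ler_wpM2l// leNgt; apply/negP => h.
move: (h); rewrite /sorted_abs count_gt_sorted; last 2 first.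
- exact: sort_sorted.
- by rewrite size_sort size_map size_enum_ord.
have /seq.permP -> : perm_eq (sort geR [seq `|u i 0| | i <- enum 'I_m])
    ([seq `|u i 0| | i <- eS] ++ [seq `|u i 0| | i <- eC]).
  by rewrite perm_sort perm_sym permE.
rewrite count_cat => hc.
suff : nth 0 sc (j - size eS) < nth 0 sc (j - size eS) by rewrite ltxx.
rewrite {2}/sc count_gt_sorted; last 2 first.
- exact: sort_sorted.
- by rewrite size_sort size_map.
have /seq.permP -> : perm_eq (sort geR [seq `|u i 0| | i <- eC]) [seq `|u i 0| | i <- eC].
  by rewrite perm_sort.
rewrite ltn_subLR//; apply: leq_trans hc _; rewrite leq_add2r.
by apply: leq_trans (count_size _ _) _; rewrite size_map.
Qed.

(** In [z] the entries of [u] on the support of [b] are erased from [b + u]. The leading sum is paid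
    twice: for the erased part [us] in the triangle inequality, and for the terms given up in
    [Jsl_disjoint_ge]. *)
Lemma Jsl_decomposable (k : nat) (b u : 'cV[R]_m) : (l0 b <= k <= m)%N ->
  Jsl lam b + Jsl lam u - Jsl lam (b + u) <= 2 * \sum_(j < k) lam j.+1 * sorted_abs u j.
Proof.
move=> bk.
pose us : 'cV[R]_m := \col_i (if b i 0 != 0 then - u i 0 else 0).
pose z : 'cV[R]_m := \col_i (if b i 0 != 0 then b i 0 else u i 0).
have h1 := Jsl_disjoint_ge (z := z) (u := u) bk (fun i => mxE _ _ _ _).
have h2 : Jsl lam us <= \sum_(j < k) lam j.+1 * sorted_abs u j.
  apply: (Jsl_masked_le (S := [set i | b i 0 != 0]%SET)).
  - rewrite (_ : #|_| = l0 b)// l0E cardE enumT /enum_mem; congr size.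
    by apply: eq_filter => i; rewrite /= inE.
  - by move=> i; rewrite inE => bi; rewrite mxE (negbTE bi).
  - by move=> i; rewrite mxE; case: ifP; rewrite ?normrN ?normr0.
have h3 : Jsl lam z <= Jsl lam (b + u) + Jsl lam us.
  apply: le_trans (Jsl_triangle _ _).
  rewrite le_eqVlt; apply/orP; left; apply/eqP; congr Jsl; apply/colP => i; rewrite !mxE.
  by case: ifPn => [_|]; [rewrite addrK|rewrite negbK => /eqP ->; rewrite add0r addr0].
lra.
Qed.

End sorted_l1.

Section cauchy_schwarz.
Context {R : realType}.

(** Lagrange's identity writes twice the difference as a double sum of squares. *)
Lemma sum_mul_sqr_le k (a b : 'I_k -> R) :
  (\sum_(i < k) a i * b i) ^+ 2 <= (\sum_(i < k) a i ^+ 2) * (\sum_(i < k) b i ^+ 2).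
Proof.
rewrite -subr_ge0.
suff : 0 <= 2 * ((\sum_(i < k) a i ^+ 2) * (\sum_(i < k) b i ^+ 2) - (\sum_(i < k) a i * b i) ^+ 2) by lra.
rewrite (_ : _ * _ = \sum_(i < k) \sum_(j < k) (a i * b j - a j * b i) ^+ 2).
  by rewrite sumr_ge0// => i _; rewrite sumr_ge0// => j _; exact: sqr_ge0.
have e i : \sum_(j < k) (a i * b j - a j * b i) ^+ 2 =
    a i ^+ 2 * (\sum_(j < k) b j ^+ 2) + b i ^+ 2 * (\sum_(j < k) a j ^+ 2) -
    a i * b i * (2 * \sum_(j < k) a j * b j).
  rewrite !mulr_sumr -big_split -sumrB; apply: eq_bigr => j _ /=; ring.
rewrite (eq_bigr _ (fun i _ => e i)) sumrB big_split/= -!mulr_suml; ring.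
Qed.

Lemma sum_mul_le_sqrt k (a b : 'I_k -> R) :
  \sum_(i < k) a i * b i <= Num.sqrt (\sum_(i < k) a i ^+ 2) * Num.sqrt (\sum_(i < k) b i ^+ 2).
Proof.
apply: le_trans (ler_norm _) _; rewrite -sqrtr_sqr -sqrtrM.
  by rewrite ler_sqrt ?sum_mul_sqr_le// mulr_ge0// sumr_ge0// => i _; exact: sqr_ge0.
by rewrite sumr_ge0// => i _; exact: sqr_ge0.
Qed.

End cauchy_schwarz.

(** * Median of the noise *)

Section weights.
Context {R : realType}.

Lemma lamw_ge0 (sigma : R) m j : 0 <= sigma -> 0 <= lamw sigma m j.
Proof. by move=> s0; rewrite mulr_ge0 ?sqrtr_ge0. Qed.

Lemma lamw_ninc (sigma : R) m i j : 0 <= sigma -> (0 < m)%N -> (0 < i <= j)%N ->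
  lamw sigma m j <= lamw sigma m i.
Proof.
move=> s0 m0 /andP[i0 ij]; rewrite ler_wpM2l// ler_wsqrtr// ler_ln ?posrE.
- by rewrite ler_wpM2l ?mulr_ge0// lef_pV2 ?posrE ?ltr0n ?ler_nat// (leq_trans i0).
- by rewrite divr_gt0 ?mulr_gt0 ?ltr0n// (leq_trans i0).
- by rewrite divr_gt0 ?mulr_gt0 ?ltr0n.
Qed.

Lemma sqr_lamw (sigma : R) m j : (0 < j <= m)%N ->
  lamw sigma m j ^+ 2 = sigma ^+ 2 * ln (2 * m%:R / j%:R).
Proof.
move=> /andP[j0 jm]; rewrite exprMn sqr_sqrtr// ln_ge0//.
rewrite ler_pdivlMr ?ltr0n// mul1r -natrM ler_nat.
by rewrite (leq_trans jm)// leq_pmull.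
Qed.

Lemma l2_ge0 m (u : 'cV[R]_m) : 0 <= l2 u. Proof. exact: sqrtr_ge0. Qed.

Lemma sqn_ge0 m (u : 'cV[R]_m) : 0 <= sqn u.
Proof. by rewrite sumr_ge0// => i _; exact: sqr_ge0. Qed.

Lemma sqr_l2 m (u : 'cV[R]_m) : l2 u ^+ 2 = sqn u.
Proof. by rewrite sqr_sqrtr// sqn_ge0. Qed.

Lemma sqnD m (u v : 'cV[R]_m) : sqn (u + v) = sqn u + 2 * dotv u v + sqn v.
Proof.
rewrite /sqn /dotv mulr_sumr -!big_split/=; apply: eq_bigr => i _.
by rewrite mxE; ring.
Qed.

Lemma l2_triangle m (u v : 'cV[R]_m) : l2 (u + v) <= l2 u + l2 v.
Proof.
rewrite -(@ler_pXn2r _ 2)// ?nnegrE ?addr_ge0 ?l2_ge0//.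
have h : dotv u v <= l2 u * l2 v by exact: sum_mul_le_sqrt.
rewrite sqrrD !sqr_l2 sqnD; lra.
Qed.

Lemma l2_le_l1 m (u : 'cV[R]_m) : l2 u <= \sum_(i < m) `|u i 0|.
Proof.
rewrite -(@ler_pXn2r _ 2)// ?nnegrE ?l2_ge0// ?sumr_ge0// sqr_l2.
rewrite /sqn expr2 mulr_suml; apply: ler_sum => i _.
rewrite -real_normK ?num_real// expr2 ler_wpM2l// (bigD1 i)//= lerDl.
by rewrite sumr_ge0.
Qed.

End weights.

Section gauss_median.
Context {R : realType}.
Variables (sigma : R) (n : nat).
Hypothesis sigma_gt0 : 0 < sigma.
Notation RR := (measurableTypeR R).
Let g : probability RR R := normal_prob 0 sigma.
Let G := iidp g n.
Local Open Scope ereal_scope.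

(* The square is linearised by integrating out an independent N(0, 1). *)
Lemma gauss_exp_sqr (x : 'I_n -> R) : (\sum_(i < n) x i ^+ 2 = 1)%R ->
  \int[G]_t (expR (3 / 8 * dott x t ^+ 2 / sigma ^+ 2))%:E = 2%:E.
Proof.
move=> x1; pose h : probability RR R := normal_prob 0 1.
(* Integrating exp(c z b) over a standard normal z yields exp(c^2 b^2 / 2), and c^2 / 2 is the
   required 3/8. *)
have [c cE] : exists c : R, (c ^+ 2 = 3 / 4)%R.
  by exists (Num.sqrt (3 / 4)); rewrite sqr_sqrtr ?divr_ge0.
have md : measurable_fun setT (fun t : n.-tuple RR => dott x t) by exact: measurable_dott.
pose F (q : n.-tuple RR * RR) := (expR (c / sigma * dott x q.1 * (q.2 : R)))%:E.
have mF : measurable_fun setT F.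
  apply/measurable_EFinP; apply: measurableT_comp => //; apply: measurable_funM.
    by apply: measurable_funM => //; exact: (measurableT_comp md measurable_fst).
  exact: (@measurable_snd _ _ (n.-tuple RR) RR).
have F0 q : 0 <= F q by rewrite lee_fin expR_ge0.
transitivity (\int[G]_t \int[h]_z F (t, z)).
  apply: eq_integral => t _; rewrite /F /= normal_mgf//; congr (expR _)%:E.
  by rewrite !exprMn cE exprVn; field; rewrite gt_eqF.
rewrite (fubini_tonelli F)//.
transitivity (\int[h]_z (expR (3 / 8 * (z : R) ^+ 2 / 1 ^+ 2))%:E); last exact: normal_exp_sqr.
apply: eq_integral => z _; rewrite /F /=.
have zE t : (c / sigma * dott x t * (z : R) = dott (fun i => c / sigma * (z : R) * x i) t)%R.
  by rewrite /dott mulr_sumr mulr_suml; apply: eq_bigr => i _; ring.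
under eq_integral do rewrite zE.
rewrite gauss_mgf//; congr (expR _)%:E.
under eq_bigr do rewrite exprMn.
rewrite -mulr_sumr x1 !exprMn cE exprVn; field.
by rewrite gt_eqF.
Qed.

Definition expsum p (x : 'I_p -> 'I_n -> R) (t : n.-tuple RR) : R :=
  \sum_(j < p) expR (3 / 8 * dott (x j) t ^+ 2 / sigma ^+ 2).

Lemma measurable_expsum p x : measurable_fun setT (@expsum p x).
Proof.
apply: measurable_sum => j; apply: measurableT_comp => //; apply: measurable_funM => //.
apply: measurable_funM => //; apply: measurable_funX; exact: measurable_dott.
Qed.

(** Each of the [p] terms has mean 2, so this is Markov's inequality at four times the mean. *)
Lemma expsum_tail p (x : 'I_p -> 'I_n -> R) : (0 < p)%N ->
  (forall j, \sum_(i < n) x j i ^+ 2 = 1)%R ->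
  G [set t | (8 * p%:R < expsum x t)%R] <= (4^-1)%:E.
Proof.
move=> p0 x1.
have mA : measurable [set t | (8 * p%:R < expsum x t)%R].
  by apply: measurable_set_lt => //; exact: measurable_expsum.
have mZ : measurable_fun setT (fun t => (expsum x t)%:E).
  by apply/measurable_EFinP; exact: measurable_expsum.
have Z0 t : (0 <= expsum x t)%R by rewrite sumr_ge0// => j _; exact: expR_ge0.
have IZ : \int[G]_t (expsum x t)%:E = (2 * p%:R)%:E.
  under eq_integral do rewrite /expsum -sumEFin.
  rewrite ge0_integral_sum//; last first.
    move=> j; apply/measurable_EFinP; apply: measurableT_comp => //; apply: measurable_funM => //.
    by apply: measurable_funM => //; apply: measurable_funX; exact: measurable_dott.
  under eq_bigr do rewrite gauss_exp_sqr//.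
  by rewrite sumEFin sumr_const card_ord mulr_natr.
have : (8 * p%:R)%:E * G [set t | (8 * p%:R < expsum x t)%R] <= (2 * p%:R)%:E.
  rewrite -IZ -(integral_cst G)//.
  apply: (@le_trans _ _ (\int[G]_(t in [set t | (8 * p%:R < expsum x t)%R]) (expsum x t)%:E)).
    apply: ge0_le_integral => //=; first exact: measurable_funTS.
    by move=> t tZ; rewrite lee_fin ltW.
  by apply: ge0_subset_integral => //= t _; rewrite lee_fin.
have : G [set t | (8 * p%:R < expsum x t)%R] \is a fin_num by exact: fin_num_measure.
case: (G _) => // r _; rewrite -EFinM !lee_fin.
have : (0 < p%:R :> R)%R by rewrite ltr0n.
nra.
Qed.

(** If every score over [S] were larger, each term would exceed [(2 * p%:R / #|S|%:R) ^+ 3], since 9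
    * 3/8 >= 3, and the terms over [S] alone would exceed [8 * p%:R]. The conclusion has the form
    expected by [sum_abs_le_sorted], so the scores need not be sorted. *)
Lemma expsum_le_sorted p (x : 'I_p -> 'I_n -> R) t (S : {set 'I_p}) :
  (expsum x t <= 8 * p%:R)%R -> (0 < #|S|)%N ->
  exists2 j, j \in S & (`|dott (x j) t| <= 3 * lamw sigma p #|S|)%R.
Proof.
move=> Zp S0; apply: contrapT => h.
have Sp : (#|S| <= p)%N by rewrite -[leqRHS](card_ord p) max_card.
have p0 : (0 < p)%N by exact: leq_trans Sp.
pose l := ln (2 * p%:R / #|S|%:R) : R.
have S0R : (0 < #|S|%:R :> R)%R by rewrite ltr0n.
have q2 : (2 <= 2 * p%:R / #|S|%:R :> R)%R by rewrite ler_pdivlMr// ler_pM2l// ler_nat.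
have l0 : (0 <= l)%R by rewrite ln_ge0// (le_trans _ q2)// ler1n.
have big j : j \in S -> ((2 * p%:R / #|S|%:R) ^+ 3 < expR (3 / 8 * dott (x j) t ^+ 2 / sigma ^+ 2))%R.
  move=> jS.
  have {}h : (3 * lamw sigma p #|S| < `|dott (x j) t|)%R.
    by rewrite ltNge; apply/negP => hj; apply: h; exists j.
  rewrite -[X in (X ^+ 3)%R]lnK ?posrE ?(lt_le_trans _ q2)// -expRM_natl ltr_expR -/l.
  rewrite ltr_pdivlMr ?exprn_gt0//.
  have : ((3 * lamw sigma p #|S|) ^+ 2 < `|dott (x j) t| ^+ 2)%R.
    by rewrite ltr_pXn2r// nnegrE// mulr_ge0// lamw_ge0// ltW.
  rewrite exprMn sqr_lamw ?S0// real_normK ?num_real// -/l.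
  have : (0 <= sigma ^+ 2 * l)%R by rewrite mulr_ge0// sqr_ge0.
  lra.
have : (8 * p%:R < expsum x t)%R.
  apply: (@le_lt_trans _ _ (\sum_(j in S) (2 * p%:R / #|S|%:R) ^+ 3)%R).
    rewrite sumr_const [leRHS](_ : _ = 8 * p%:R * (p%:R / #|S|%:R) ^+ 2)%R; last first.
      by rewrite -[LHS]mulr_natr; field; rewrite gt_eqF.
    rewrite ler_peMr ?mulr_ge0// expr_ge1 ?divr_ge0//.
    by rewrite ler_pdivlMr// mul1r ler_nat.
  rewrite /expsum; apply: (@lt_le_trans _ _ (\sum_(j in S) expR (3 / 8 * dott (x j) t ^+ 2 / sigma ^+ 2))%R).
    have /card_gt0P[j0 j0S] := S0.
    rewrite (bigD1 j0)//= [ltRHS](bigD1 j0)//= ltr_leD ?big//.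
    by apply: ler_sum => j /andP[jS _]; rewrite ltW// big.
  rewrite [leRHS](bigID (mem S))/= lerDl sumr_ge0// => j _; exact: expR_ge0.
by rewrite ltNge Zp.
Qed.

End gauss_median.

(** * Noise event *)

Section noise_bound.
Context {R : realType}.
Variables (n p : nat) (X : 'M[R]_(n, p)) (sigma tau : R).
Hypotheses (sigma_gt0 : 0 < sigma) (tau_gt0 : 0 < tau).
Hypotheses (n_gt0 : (0 < n)%N) (p_gt0 : (0 < p)%N).
Hypothesis X1 : forall j : 'I_p, \sum_(i < n) X i j ^+ 2 = 1.
Notation RR := (measurableTypeR R).
Let g : probability RR R := normal_prob 0 sigma.
Let G := iidp g n.
Let J (q : 'cV[R]_p * 'cV[R]_n) := Jsl (lamw sigma p) q.1 + Jsl (lamw sigma n) q.2.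
Let img (q : 'cV[R]_p * 'cV[R]_n) : 'cV[R]_n := X *m q.1 + q.2.
Let B q := 32 / 5 * J q + tau * l2 (img q).
Let ip q (x : n.-tuple RR) := dott (fun i => img q i 0) x.

Let lt_ge0 j : 0 <= lamw sigma p j. Proof. by rewrite lamw_ge0// ltW. Qed.
Let l_ge0 j : 0 <= lamw sigma n j. Proof. by rewrite lamw_ge0// ltW. Qed.
Let lt_ninc i j : (0 < i <= j)%N -> lamw sigma p j <= lamw sigma p i.
Proof. by apply: lamw_ninc => //; exact: ltW. Qed.
Let l_ninc i j : (0 < i <= j)%N -> lamw sigma n j <= lamw sigma n i.
Proof. by apply: lamw_ninc => //; exact: ltW. Qed.

Let J_ge0 q : 0 <= J q. Proof. by rewrite addr_ge0 ?Jsl_ge0. Qed.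

Let B_ge0 q : 0 <= B q.
Proof. by rewrite addr_ge0 ?mulr_ge0 ?divr_ge0 ?l2_ge0// ltW. Qed.

Let imgD q q' : img (q + q') = img q + img q'.
Proof. by rewrite /img mulmxDr; apply/colP => i; rewrite !mxE; ring. Qed.

Let ipD q q' x : ip (q + q') x = ip q x + ip q' x.
Proof.
rewrite /ip /dott -big_split/=; apply: eq_bigr => i _.
by rewrite imgD [_ i 0]mxE mulrDl.
Qed.

Let BD q q' : B (q + q') <= B q + B q'.
Proof.
have h1 : Jsl (lamw sigma p) (q.1 + q'.1) <= Jsl (lamw sigma p) q.1 + Jsl (lamw sigma p) q'.1.
  exact: Jsl_triangle.
have h2 : Jsl (lamw sigma n) (q.2 + q'.2) <= Jsl (lamw sigma n) q.2 + Jsl (lamw sigma n) q'.2.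
  exact: Jsl_triangle.
have h3 : tau * l2 (img (q + q')) <= tau * (l2 (img q) + l2 (img q')).
  by rewrite ler_pM2l// imgD l2_triangle.
rewrite /B /J /=; lra.
Qed.

(** The pairing splits into scores against the columns of [X], weighted by [u], and scores against
    the coordinate vectors, weighted by [v]. *)
Lemma ip_le_J x :
  expsum sigma (fun j i => X i j) x <= 8 * p%:R ->
  expsum sigma (fun j i : 'I_n => (i == j)%:R) x <= 8 * n%:R ->
  forall q, ip q x <= 3 * J q.
Proof.
move=> hX hI [u v].
have e1 : \sum_(j < p) dott (fun i => X i j) x * u j 0 <= 3 * Jsl (lamw sigma p) u.
  apply: (@le_trans _ _ (\sum_(j < p) `|dott (fun i => X i j) x| * `|u j 0|)).
    by apply: ler_sum => j _; rewrite -normrM ler_norm.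
  apply: le_trans (sum_abs_le_sorted (b := fun j => 3 * lamw sigma p j.+1) u _) _.
    move=> S S0; rewrite prednK//.
    exact: (expsum_le_sorted sigma_gt0 hX S0).
  by rewrite /Jsl mulr_sumr; apply: ler_sum => j _; rewrite mulrA.
have e2 : \sum_(j < n) dott (fun i => (i == j)%:R) x * v j 0 <= 3 * Jsl (lamw sigma n) v.
  apply: (@le_trans _ _ (\sum_(j < n) `|dott (fun i => (i == j)%:R) x| * `|v j 0|)).
    by apply: ler_sum => j _; rewrite -normrM ler_norm.
  apply: le_trans (sum_abs_le_sorted (b := fun j => 3 * lamw sigma n j.+1) v _) _.
    move=> S S0; rewrite prednK//.
    exact: (expsum_le_sorted sigma_gt0 hI S0).
  by rewrite /Jsl mulr_sumr; apply: ler_sum => j _; rewrite mulrA.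
rewrite /J /= mulrDr; apply: le_trans (lerD e1 e2).
rewrite le_eqVlt; apply/orP; left; apply/eqP.
rewrite /ip /dott /img /=.
under eq_bigr do rewrite mxE mulrDl.
rewrite big_split/=; congr (_ + _).
  under eq_bigr do rewrite mxE mulr_suml.
  rewrite exchange_big/=; apply: eq_bigr => j _; rewrite mulr_suml.
  by apply: eq_bigr => i _; ring.
apply: eq_bigr => j _; rewrite (bigD1 j)//= eqxx mul1r big1 ?addr0; first by rewrite mulrC.
by move=> i /negbTE ->; rewrite mul0r.
Qed.

Section countable.
Variable q : nat -> 'cV[R]_p * 'cV[R]_n.
(** Division by the bound turns the claim into [maxdot w N x <= 1]. As [B] is at least
    [tau * l2 (img (q k))], every form has norm at most 1/tau; when [B (q k)] is 0, its inverse is 0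
    and so is the form. *)
Let w k i := img (q k) i 0 / B (q k).

Let dott_w k x : dott (w k) x = ip (q k) x / B (q k).
Proof. by rewrite /ip /dott mulr_suml; apply: eq_bigr => i _; rewrite /w; ring. Qed.

Let w_norm k : \sum_(i < n) w k i ^+ 2 <= tau ^- 2.
Proof.
have -> : \sum_(i < n) w k i ^+ 2 = sqn (img (q k)) / B (q k) ^+ 2.
  by rewrite /sqn mulr_suml; apply: eq_bigr => i _; rewrite /w exprMn exprVn.
have [->|B0] := eqVneq (B (q k)) 0.
  by rewrite expr0n invr0 mulr0 invr_ge0 exprn_ge0// ltW.
have Bp : 0 < B (q k) by rewrite lt_neqAle eq_sym B0 B_ge0.
rewrite ler_pdivrMr ?exprn_gt0// mulrC ler_pdivlMr ?exprn_gt0//.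
rewrite -sqr_l2 -exprMn ler_pXn2r ?nnegrE ?mulr_ge0 ?l2_ge0 ?(ltW tau_gt0) ?B_ge0//.
by rewrite mulrC /B lerDr mulr_ge0// divr_ge0.
Qed.

Let median_prob : exists2 A, measurable A &
  (A `<=` [set x | forall q, ip q x <= 3 * J q]) /\ ((2^-1)%:E <= G A)%E.
Proof.
pose A1 := [set x | 8 * p%:R < expsum sigma (fun j i => X i j) x].
pose A2 := [set x | 8 * n%:R < expsum sigma (fun j i : 'I_n => (i == j)%:R) x].
have mA1 : measurable A1 by apply: measurable_set_lt => //; exact: measurable_expsum.
have mA2 : measurable A2 by apply: measurable_set_lt => //; exact: measurable_expsum.
have mA12 : measurable (A1 `|` A2) by exact: measurableU.
exists (~` (A1 `|` A2)); first exact: measurableC.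
split.
  move=> x /= /not_orP[/negP + /negP +]; rewrite -!leNgt => h1 h2.
  exact: ip_le_J.
have h1 : (G A1 <= (4^-1)%:E)%E by exact: expsum_tail.
have h2 : (G A2 <= (4^-1)%:E)%E.
  apply: expsum_tail => // j; rewrite (bigD1 j)//= eqxx expr1n big1 ?addr0//.
  by move=> i /negbTE ->; rewrite expr0n.
have h12 : (G (A1 `|` A2) <= (4^-1)%:E + (4^-1)%:E)%E.
  exact: le_trans (measureU2 _ _ _) (leeD h1 h2).
rewrite probability_setC//.
have : G (A1 `|` A2) \is a fin_num by exact: fin_num_measure.
move: h12; case: (G (A1 `|` A2)) => // r; rewrite -EFinD -EFinB !lee_fin => + _.
lra.
Qed.

Lemma countable_noise_bound : exists2 E : set (n.-tuple RR), measurable E &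
  ((1 - 4 * expR (- (tau ^+ 2 / (2304 * sigma ^+ 2))))%:E <= G E)%E /\
  forall x, E x -> forall k, ip (q k) x <= B (q k).
Proof.
pose F N := [set x | 1 < maxdot w N x].
have mF N : measurable (F N).
  by apply: measurable_set_lt => //; exact: measurable_maxdot.
pose c := 4 * expR (- (tau ^+ 2 / (2304 * sigma ^+ 2))).
have FN N : (G (F N) <= c%:E)%E.
  (* The exponent is - th/16 + (9/4) th^2 sigma^2 / tau^2. This is its minimiser, with value -
     th/32, and 2304 = 72 * 32. *)
  pose th := tau ^+ 2 / (72 * sigma ^+ 2).
  have th0 : 0 <= th by rewrite ltW// divr_gt0 ?mulr_gt0.
  (* The median constant after normalisation: 3 divided by 32/5 is 15/32. *)
  have h : ((2^-1)%:E <= G [set x | (maxdot w N x <= 15 / 32)%R])%E.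
    have [A mA [AJ hA]] := median_prob.
    apply: (le_trans hA); apply: le_measure.
    - exact: mem_set.
    - by apply: mem_set; apply: measurable_set_le => //; exact: measurable_maxdot.
    move=> x /AJ hx /=; rewrite /maxdot.
    apply: (best_ind (P := fun v => dott v x <= 15 / 32)); first by rewrite dott0 divr_ge0.
    move=> k _; rewrite dott_w.
    have [->|B0] := eqVneq (B (q k)) 0; first by rewrite invr0 mulr0 divr_ge0.
    have Bp : 0 < B (q k) by rewrite lt_neqAle eq_sym B0 B_ge0.
    rewrite ler_pdivrMr//; have := hx (q k).
    have : 0 <= tau * l2 (img (q k)) by rewrite mulr_ge0 ?l2_ge0// ltW.
    rewrite /B; lra.
  have t20 : 0 <= tau ^- 2 by rewrite invr_ge0 exprn_ge0// ltW.
  have := maxdot_tail sigma_gt0 th0 (q := 2^-1) _ (fun k _ => w_norm k) t20 h.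
  rewrite -/(F N) invr_gt0 ltr0n => /(_ isT) hh; apply: (le_trans hh).
  rewrite lee_fin /c [leLHS](_ : _ = 4 * expR (2 * th * (15 / 32) + 9 / 4 * th ^+ 2 * sigma ^+ 2 / tau ^+ 2 - th)); last by field.
  rewrite ler_pM2l// ler_expR /th le_eqVlt; apply/orP; left; apply/eqP.
  by field; rewrite !gt_eqF.
have mU : measurable (\bigcup_N F N) by exact: bigcup_measurable.
have FU : (G (\bigcup_N F N) <= c%:E)%E.
  (* Adding a form can only increase the maximum, so continuity from below carries the bound,
     uniform in [N], to the union. *)
  have nd : nondecreasing_seq F.
    apply/nondecreasing_seqP => N; apply/subsetPset => x /= xN; apply: (lt_le_trans xN).
    by apply: (best_ind (P := fun v => dott v x <= maxdot w N.+1 x)) => [|k kN]; [rewrite dott0 maxdot_ge0|rewrite maxdot_ge// ltnS ltnW].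
  have cv := nondecreasing_cvg_mu (mu := G) mF mU nd.
  rewrite -(cvg_lim _ cv)//; apply: lime_le; first by apply/cvg_ex; eexists; exact: cv.
  by apply: nearW => N; exact: FN.
exists (~` \bigcup_N F N); first exact: measurableC.
split.
  rewrite probability_setC//.
  have : G (\bigcup_N F N) \is a fin_num by exact: fin_num_measure.
  move: FU; case: (G _) => // r; rewrite -EFinB !lee_fin /c => + _; lra.
move=> x /= xF k.
have h : dott (w k) x <= 1.
  rewrite leNgt; apply/negP => h; apply: xF; exists k.+1 => //.
  by apply: (lt_le_trans h); exact: maxdot_ge.
(* When [B (q k)] vanishes the normalised form says nothing, but then [img (q k)] is zero because
   [tau] is positive. *)
have [B0|B0] := eqVneq (B (q k)) 0; last first.
  by move: h; rewrite dott_w ler_pdivrMr ?mul1r// lt_neqAle eq_sym B0 B_ge0.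
have l20 : l2 (img (q k)) = 0.
  apply/eqP; rewrite eq_le l2_ge0 andbT; move: B0 (J_ge0 (q k)); rewrite /B => B0 JJ.
  rewrite -(ler_pM2l tau_gt0) mulr0; lra.
have : sqn (img (q k)) = 0 by rewrite -sqr_l2 l20 expr0n.
move=> /psumr_eq0P h0; rewrite B0 /ip /dott big1// => i _.
have /eqP : img (q k) i 0 ^+ 2 = 0 by apply: h0 => // j _; exact: sqr_ge0.
by rewrite sqrf_eq0 => /eqP ->; rewrite mul0r.
Qed.

End countable.

(** An enumeration of all rational pairs through their codes; numbers that code nothing give the
    zero pair. *)
Definition ratpair (k : nat) : 'cV[R]_p * 'cV[R]_n :=
  if (unpickle k : option ('cV[rat]_p * 'cV[rat]_n)%type) is Some q
  then (map_mx ratr q.1, map_mx ratr q.2) else (0, 0).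

Let l1 (q : 'cV[R]_p * 'cV[R]_n) := \sum_(j < p) `|q.1 j 0| + \sum_(i < n) `|q.2 i 0|.

Lemma ratpair_dense (q : 'cV[R]_p * 'cV[R]_n) (e : R) : 0 < e ->
  exists k, l1 (ratpair k - q) <= (p + n)%:R * e.
Proof.
move=> e0.
have dense (x : R) : {r : rat | `|ratr r - x| <= e}.
  apply: cid; have xe : x - e < x + e by lra.
  have [r] := rat_in_itvoo xe; rewrite in_itv/= => /andP[h1 h2].
  by exists r; rewrite ler_norml; apply/andP; split; lra.
pose u : 'cV[rat]_p := \col_j sval (dense (q.1 j 0)).
pose v : 'cV[rat]_n := \col_j sval (dense (q.2 j 0)).
exists (pickle (u, v)); rewrite /ratpair pickleK /l1 natrD mulrDl lerD//=.
  rewrite mulr_natl -[in leRHS](card_ord p) -sumr_const; apply: ler_sum => j _.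
  by rewrite !mxE; case: (dense _).
rewrite mulr_natl -[in leRHS](card_ord n) -sumr_const; apply: ler_sum => j _.
by rewrite !mxE; case: (dense _).
Qed.

Let img_coord q i : `|img q i 0| <= l1 q.
Proof.
rewrite /img !mxE (le_trans (ler_normD _ _))// lerD//; last first.
  by rewrite (bigD1 i)//= lerDl sumr_ge0.
rewrite (le_trans (ler_norm_sum _ _ _))//; apply: ler_sum => j _.
rewrite normrM ler_piMl// -(@ler_pXn2r _ 2)// ?nnegrE// real_normK ?num_real// expr1n.
by rewrite -(X1 j) (bigD1 i)//= lerDl sumr_ge0// => k _; exact: sqr_ge0.
Qed.

(** Both sides are subadditive in [q] and at most a multiple, depending on [x], of the l1 size;
    approximating [q] by rational pairs thus extends the countable statement on the same event. *)
Lemma noise_bound : exists2 E : set (n.-tuple RR), measurable E &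
  ((1 - 4 * expR (- (tau ^+ 2 / (2304 * sigma ^+ 2))))%:E <= G E)%E /\
  forall x, E x -> forall q, ip q x <= B q.
Proof.
have [E mE [GE hE]] := countable_noise_bound ratpair.
exists E => //; split => // x Ex q.
pose C := 32 / 5 * (lamw sigma p 1 + lamw sigma n 1) + tau * n%:R + \sum_(i < n) `|tnth x i : R|.
have C0 : 0 <= C.
  by rewrite !addr_ge0 ?mulr_ge0 ?divr_ge0 ?addr_ge0 ?sumr_ge0// ltW.
have l1_ge0 q' : 0 <= l1 q' by rewrite addr_ge0 ?sumr_ge0.
have bound q' : B q' + `|ip q' x| <= C * l1 q'.
  have b1 : Jsl (lamw sigma p) q'.1 <= lamw sigma p 1 * l1 q'.
    apply: le_trans (Jsl_le_l1 lt_ninc q'.1) _.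
    by rewrite ler_wpM2l// lerDl sumr_ge0.
  have b2 : Jsl (lamw sigma n) q'.2 <= lamw sigma n 1 * l1 q'.
    apply: le_trans (Jsl_le_l1 l_ninc q'.2) _.
    by rewrite ler_wpM2l// lerDr sumr_ge0.
  have b3 : tau * l2 (img q') <= tau * (n%:R * l1 q').
    rewrite ler_pM2l// (le_trans (l2_le_l1 _))//.
    rewrite mulr_natl -[in leRHS](card_ord n) -sumr_const; apply: ler_sum => i _.
    exact: img_coord.
  have b4 : `|ip q' x| <= (\sum_(i < n) `|tnth x i : R|) * l1 q'.
    rewrite /ip /dott (le_trans (ler_norm_sum _ _ _))// mulr_suml; apply: ler_sum => i _.
    by rewrite normrM mulrC ler_wpM2l// img_coord.
  rewrite /B /J /C; lra.
apply/ler_addgt0Pr => e e0.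
have e'0 : 0 < e / (C * (p + n)%:R + 1) by rewrite divr_gt0// ltr_wpDl// mulr_ge0.
have [k hk] := ratpair_dense q e'0.
have h1 := hE x Ex k.
have h2 : ip q x = ip (ratpair k) x - ip (ratpair k - q) x.
  have := ipD (ratpair k - q) q x; rewrite subrK => ->; ring.
have h3 : B (ratpair k) <= B (ratpair k - q) + B q by have := BD (ratpair k - q) q; rewrite subrK.
have h4 := bound (ratpair k - q).
have h5 : C * l1 (ratpair k - q) <= e.
  apply: (@le_trans _ _ (C * ((p + n)%:R * (e / (C * (p + n)%:R + 1))))).
    by rewrite ler_wpM2l.
  rewrite mulrA mulrA ler_pdivrMr; last by rewrite ltr_wpDl// mulr_ge0.
  have := ltW e0; set z := (p + n)%:R; lra.
have := ler_norm (- ip (ratpair k - q) x); rewrite normrN => h6.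
rewrite h2; lra.
Qed.

End noise_bound.

(** * Transfer to an arbitrary probability space *)

Section noise_event.
Context {R : realType}.
Variables (n p : nat) (X : 'M[R]_(n, p)) (sigma tau : R).
Hypotheses (sigma_gt0 : 0 < sigma) (tau_gt0 : 0 < tau).
Hypotheses (n_gt0 : (0 < n)%N) (p_gt0 : (0 < p)%N).
Hypothesis X1 : forall j : 'I_p, \sum_(i < n) X i j ^+ 2 = 1.

(** Independence and the marginal laws give the probability of every box, hence the law of the noise
    tuple; the event is a preimage under that tuple. *)
Lemma noise_event (d : measure_display) (T : measurableType d) (P : probability T R)
    (eps : 'I_n -> T -> R) :
  (forall i, measurable_fun setT (eps i)) ->
  (forall i (A : set R), measurable A -> P (eps i @^-1` A) = normal_prob 0 sigma A) ->
  indep_rvs P eps ->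
  exists2 E : set T, measurable E &
    ((1 - 4 * expR (- (tau ^+ 2 / (2304 * sigma ^+ 2))))%:E <= P E)%E /\
    forall w, E w -> forall (u : 'cV[R]_p) (v : 'cV[R]_n),
      dotv (X *m u + v) (\col_i eps i w) <=
      32 / 5 * (Jsl (lamw sigma p) u + Jsl (lamw sigma n) v) + tau * l2 (X *m u + v).
Proof.
move=> meps law indep.
pose RR := measurableTypeR R.
pose f (w : T) : n.-tuple RR := [tuple (eps i w : RR) | i < n].
have mf : measurable_fun setT f.
  apply/measurable_fun_tnthP => i /=.
  rewrite (_ : _ \o _ = eps i); first exact: meps.
  by apply/funext => w /=; rewrite tnth_mktuple.
pose mfun_f : {mfun T >-> n.-tuple RR} := HB.pack f (isMeasurableFun.Build _ _ _ _ f mf).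
pose g : probability RR R := normal_prob 0 sigma.
have lawE B : measurable B -> P (f @^-1` B) = iidp g n B.
  apply: (tuple_prob_unique (P := distribution P mfun_f)) => A mA.
  rewrite iidp_box//.
  have fE : f @^-1` [set t | forall i, A i (tnth t i)] =
      \bigcap_(i in [set: 'I_n]) (eps i @^-1` A i).
    apply/seteqP; split => w /=; first by move=> h i _; have := h i; rewrite tnth_mktuple.
    by move=> h i; rewrite tnth_mktuple; exact: h.
  transitivity (P (\bigcap_(i in [set: 'I_n]) (eps i @^-1` A i))); first by rewrite -fE.
  rewrite indep; last by move=> i; exact: mA.
  by apply: eq_bigr => i _; exact: (law i _ (mA i)).
have [E mE [GE hE]] := noise_bound sigma_gt0 tau_gt0 n_gt0 p_gt0 X1.
exists (f @^-1` E); first by rewrite -[X in measurable X]setTI; exact: (mf measurableT _ mE).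
split; first by rewrite lawE.
move=> w Ew u v; have := hE _ Ew (u, v).
rewrite /dott /dotv /=; under eq_bigr do rewrite tnth_mktuple.
by under [X in _ -> X <= _]eq_bigr do rewrite [X in _ * X]mxE.
Qed.

End noise_event.

(** * Deterministic analysis *)

Section weight_sums.
Context {R : realType}.
Variables (sigma : R) (p k : nat).
Hypotheses (k_gt0 : (0 < k)%N) (kp : (k <= p)%N).

Let p_gt0 : 0 < p%:R :> R. Proof. by rewrite ltr0n (leq_trans k_gt0). Qed.
Let k_gt0R : 0 < k%:R :> R. Proof. by rewrite ltr0n. Qed.

Lemma ln_2e_div : ln (2 * expR 1 * p%:R / k%:R) = ln (2 * p%:R : R) + 1 - ln k%:R.
Proof.
rewrite ln_div ?posrE ?mulr_gt0 ?expR_gt0// (_ : 2 * expR 1 * p%:R = 2 * p%:R * expR 1); last by ring.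
by rewrite lnM ?posrE ?mulr_gt0 ?expR_gt0// expRK.
Qed.

(** In substance k! >= (k/e)^k. The induction on the number q of terms reduces to ln(1 + 1/q) <=
    1/q, the first term being treated apart. *)
Lemma sum_sqr_lamw_le :
  \sum_(j < k) lamw sigma p j.+1 ^+ 2 <= sigma ^+ 2 * (k%:R * ln (2 * expR 1 * p%:R / k%:R)).
Proof.
rewrite ln_2e_div.
have sE (j : 'I_k) : lamw sigma p j.+1 ^+ 2 = sigma ^+ 2 * (ln (2 * p%:R) - ln j.+1%:R).
  rewrite sqr_lamw ?(leq_trans (ltn_ord j))// ln_div// posrE ?mulr_gt0//.
under eq_bigr do rewrite sE.
rewrite -mulr_sumr ler_wpM2l ?sqr_ge0//.
elim: (k) => [|q IH]; first by rewrite big_ord0 mul0r.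
rewrite big_ord_recr/=; apply: (le_trans (lerD IH (lexx _))).
case: q {IH} => [|q]; first by rewrite mul0r add0r mul1r ln1; lra.
suff h : q.+1%:R * (ln q.+2%:R - ln q.+1%:R) <= 1 :> R.
  rewrite -[q.+2%:R]natr1 mulrDl mul1r [in q.+1%:R + 1]natr1; move: h; set x : R := q.+1%:R; lra.
have q0 : 0 < q.+1%:R :> R by rewrite ltr0n.
rewrite -ln_div ?posrE ?ltr0n// mulrC -ler_pdivlMr//.
have -> : q.+2%:R / q.+1%:R = 1 + q.+1%:R^-1 :> R.
  by rewrite -[q.+2%:R]natr1 mulrDl divff ?gt_eqF// mul1r.
by rewrite mul1r le_ln1Dx// (lt_trans (ltrN10 _))// invr_gt0.
Qed.

(** The last of the [k] leading weights is the smallest. This bound is what places [tau] below 96 A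
    and 96 B. *)
Lemma sum_sqr_lamw_ge :
  sigma ^+ 2 * (k%:R * ln (2 * p%:R / k%:R)) <= \sum_(j < k) lamw sigma p j.+1 ^+ 2.
Proof.
rewrite mulrCA -sqr_lamw ?k_gt0// mulr_natl -[X in _ *+ X](card_ord k) -sumr_const.
apply: ler_sum => j _; rewrite !sqr_lamw ?k_gt0// ?(leq_trans (ltn_ord j))//.
rewrite ler_wpM2l ?sqr_ge0// ler_ln ?posrE ?divr_gt0 ?mulr_gt0//.
by rewrite ler_pM2l ?mulr_gt0// lef_pV2 ?posrE ?ltr0n// ler_nat.
Qed.

Lemma ln_2_le : ln 2 <= k%:R * ln (2 * p%:R / k%:R) :> R.
Proof.
have h : ln 2 <= ln (2 * p%:R / k%:R) :> R.
  rewrite ler_ln ?posrE ?divr_gt0 ?mulr_gt0//.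
  by rewrite ler_pdivlMr// ler_pM2l// ler_nat.
apply: (le_trans h); rewrite ler_peMl ?ler1n//.
by apply: le_trans h; rewrite ln_ge0// ler1n.
Qed.

Lemma expR_mul_ln : expR (- (k%:R * ln (2 * p%:R / k%:R))) = (k%:R / (2 * p%:R)) ^+ k :> R.
Proof.
rewrite -mulrN expRM_natl -lnV ?posrE ?divr_gt0 ?mulr_gt0// lnK ?posrE ?invr_gt0 ?divr_gt0 ?mulr_gt0//.
by rewrite invf_div.
Qed.

End weight_sums.

(** * Optimality of the penalised least squares estimator *)

Section slope_basic.
Context {R : realType}.
Variables (n p : nat) (X : 'M[R]_(n, p)) (lamt lam : nat -> R) (rho : R).
Hypotheses (rho_ge0 : 0 <= rho).
Hypotheses (lamt_ge0 : forall j, 0 <= lamt j) (lam_ge0 : forall j, 0 <= lam j).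
Hypothesis lamt_ninc : forall i j, (0 < i <= j)%N -> lamt j <= lamt i.
Hypothesis lam_ninc : forall i j, (0 < i <= j)%N -> lam j <= lam i.

Lemma Jsl_convex m (l : nat -> R) (a b : 'cV[R]_m) (t : R) : 0 <= t <= 1 ->
  (forall j, 0 <= l j) -> (forall i j, (0 < i <= j)%N -> l j <= l i) ->
  Jsl l (a + t *: (b - a)) <= Jsl l a + t * (Jsl l b - Jsl l a).
Proof.
move=> /andP[t0 t1] l0 ln.
rewrite (_ : a + _ = (1 - t) *: a + t *: b); last first.
  by apply/colP => i; rewrite !mxE; ring.
have h1 : 0 <= 1 - t by rewrite subr_ge0.
have := Jsl_triangle l0 ln ((1 - t) *: a) (t *: b).
have := Jsl_scale ln a h1; have := Jsl_scale ln b t0.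
lra.
Qed.

Lemma dotvDl m (a b c : 'cV[R]_m) : dotv (a + b) c = dotv a c + dotv b c.
Proof. by rewrite /dotv -big_split/=; apply: eq_bigr => i _; rewrite mxE mulrDl. Qed.

Lemma dotvC m (a b : 'cV[R]_m) : dotv a b = dotv b a.
Proof. by rewrite /dotv; apply: eq_bigr => i _; rewrite mulrC. Qed.

Lemma dotvZr m t (a b : 'cV[R]_m) : dotv a (t *: b) = t * dotv a b.
Proof. by rewrite /dotv mulr_sumr; apply: eq_bigr => i _; rewrite mxE; ring. Qed.

Lemma dotvv m (a : 'cV[R]_m) : dotv a a = sqn a.
Proof. by apply: eq_bigr => i _; rewrite expr2. Qed.

Lemma sqnZ m t (a : 'cV[R]_m) : sqn (t *: a) = t ^+ 2 * sqn a.
Proof. by rewrite /sqn mulr_sumr; apply: eq_bigr => i _; rewrite mxE exprMn. Qed.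

(* First-order optimality along the segment to the truth; this gains a factor
   2 over merely comparing the objective at its two ends. *)
Lemma slope_basic_inequality (betas bh : 'cV[R]_p) (mus mh e : 'cV[R]_n) :
  let y := X *m betas + mus + e in
  let obj (b : 'cV[R]_p) (m : 'cV[R]_n) := sqn (y - X *m b - m) + 2 * rho * Jsl lamt b + 2 * rho * Jsl lam m in
  (forall b m, obj bh mh <= obj b m) ->
  forall d, d = X *m (bh - betas) + (mh - mus) ->
  sqn d <= dotv d e + rho * (Jsl lamt betas - Jsl lamt bh + (Jsl lam mus - Jsl lam mh)).
Proof.
move=> y obj opt d dE.
set D := Jsl lamt betas - Jsl lamt bh + (Jsl lam mus - Jsl lam mh).
pose r := e - d.
have rE : y - X *m bh - mh = r.
  rewrite /r /y dE mulmxBr; apply/colP => i; rewrite !mxE; ring.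
have rd : dotv r d = dotv d e - sqn d.
  rewrite /r (_ : e - d = e + (-1) *: d); last by rewrite scaleN1r.
  by rewrite dotvDl dotvC (dotvC _ d) dotvZr dotvv; ring.
have step t : 0 < t -> t <= 1 -> 0 <= 2 * dotv r d + t * sqn d + 2 * rho * D.
  move=> t0 t1; have t01 : 0 <= t <= 1 by rewrite ltW.
  have := opt (bh + t *: (betas - bh)) (mh + t *: (mus - mh)).
  rewrite /obj rE.
  have -> : y - X *m (bh + t *: (betas - bh)) - (mh + t *: (mus - mh)) = r + t *: d.
    rewrite -rE dE mulmxDr -scalemxAr !mulmxBr; apply/colP => i; rewrite !mxE; ring.
  rewrite sqnD dotvZr sqnZ.
  have c1 := ler_wpM2l rho_ge0 (Jsl_convex bh betas t01 lamt_ge0 lamt_ninc).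
  have c2 := ler_wpM2l rho_ge0 (Jsl_convex mh mus t01 lam_ge0 lam_ninc).
  move=> h; rewrite -(pmulr_rge0 _ t0) /D; lra.
rewrite leNgt; apply/negP => h.
pose z := sqn d - dotv d e - rho * D.
have z0 : 0 < z by rewrite /z; lra.
have d0 := sqn_ge0 d.
(* Replaces the limit as t tends to 0: the quadratic term [t * sqn d] stays below [z], while the
   linear part equals [- 2 * z]. *)
pose t := z / (sqn d + z + 1).
have den : 0 < sqn d + z + 1 by lra.
have t0 : 0 < t by rewrite divr_gt0.
have t1 : t <= 1 by rewrite ler_pdivrMr// mul1r; lra.
have := step t t0 t1; rewrite rd.
have : t * sqn d < z.
  rewrite /t mulrAC ltr_pdivrMr// -subr_gt0; have : 0 < z * (z + 1) by rewrite mulr_gt0// addr_gt0.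
  lra.
rewrite /z; lra.
Qed.

End slope_basic.

(** * From the noise event to the rate *)

Section slope_rate.
Context {R : realType}.

Lemma head_le_l2 m k (lam : nat -> R) (u : 'cV[R]_m) : (k <= m)%N ->
  \sum_(j < k) lam j.+1 * sorted_abs u j <= Num.sqrt (\sum_(j < k) lam j.+1 ^+ 2) * l2 u.
Proof.
move=> km; apply: le_trans (sum_mul_le_sqrt (fun j : 'I_k => lam j.+1) (fun j : 'I_k => sorted_abs u j)) _.
rewrite ler_wpM2l ?sqrtr_ge0// ler_wsqrtr// -sum_sqr_sorted_abs.
rewrite (big_ord_widen m (fun j => sorted_abs u j ^+ 2) km) [leRHS](bigID (fun j : 'I_m => (j < k)%N))/=.
by rewrite lerDl sumr_ge0// => j _; exact: sqr_ge0.
Qed.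

(* D is the prediction error, nu and nv the two estimation errors, A and B the
   square roots of the two sums of squared weights, S the total penalty. *)
Lemma rate_in_cone (rho tau D nu nv A B K : R) : 0 <= rho -> 0 < K <= 1 ->
  0 <= D -> 0 <= tau <= 96 * A -> 0 <= A -> 0 <= B -> 0 <= nu -> 0 <= nv ->
  K * (nu ^+ 2 + nv ^+ 2) <= D ^+ 2 ->
  D ^+ 2 <= tau * D + 2 * rho * (A * nu + B * nv) ->
  nu ^+ 2 + nv ^+ 2 <= (18432 + 8 * rho ^+ 2) / K ^+ 2 * (A ^+ 2 + B ^+ 2).
Proof.
move=> rho0 /andP[K0 K1] D0 /andP[tau0 tauA] A0 B0 nu0 nv0 hK hD.
set e := nu ^+ 2 + nv ^+ 2 in hK *; set L := A ^+ 2 + B ^+ 2.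
have L0 : 0 <= L by rewrite addr_ge0 ?sqr_ge0.
have t2 : tau ^+ 2 <= 9216 * L.
  have : tau ^+ 2 <= (96 * A) ^+ 2 by rewrite ler_pXn2r ?nnegrE ?mulr_ge0.
  rewrite exprMn /L; have := sqr_ge0 B; lra.
(* Young's inequality here and in [hA], [hB] is tuned so that, after multiplication by K, the terms
   K D^2 / 4 and K^2 e / 4 are absorbed by K D^2. Half of K D^2 is left, which doubles 9216 and 4
   into 18432 and 8. *)
have tD : tau * D <= D ^+ 2 / 4 + tau ^+ 2.
  have := sqr_ge0 (D / 2 - tau); rewrite sqrrB; lra.
have hA : K * (2 * rho * (A * nu)) <= 4 * rho ^+ 2 * A ^+ 2 + K ^+ 2 * nu ^+ 2 / 4.
  have := sqr_ge0 (2 * rho * A - K * nu / 2); rewrite sqrrB; lra.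
have hB : K * (2 * rho * (B * nv)) <= 4 * rho ^+ 2 * B ^+ 2 + K ^+ 2 * nv ^+ 2 / 4.
  have := sqr_ge0 (2 * rho * B - K * nv / 2); rewrite sqrrB; lra.
have K2e : K ^+ 2 * e <= K * D ^+ 2 by rewrite expr2 -mulrA ler_pM2l.
have h1 : K * D ^+ 2 <= K * (D ^+ 2 / 4 + 9216 * L) + 4 * rho ^+ 2 * L + K ^+ 2 * e / 4.
  have : K * D ^+ 2 <= K * (tau * D + 2 * rho * (A * nu + B * nv)) by rewrite ler_pM2l.
  have : K * (tau * D) <= K * (D ^+ 2 / 4 + 9216 * L) by rewrite ler_pM2l//; lra.
  rewrite /L /e; lra.
have KL : K * L <= L by rewrite ler_piMl.
rewrite mulrAC ler_pdivlMr ?exprn_gt0//.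
move: h1 K2e KL; rewrite -/e; lra.
Qed.

(** Completing the square in D leaves eta S <= tau^2 / 4. As [tau] is below both 96 A and 96 B, tau
    (nu + nv) is at most 96 S / 5, so nu + nv is at most 24 tau / (5 eta). Dividing by K^2 only
    weakens the bound and matches the other case. *)
Lemma rate_out_cone (eta tau D nu nv A B S K : R) : 0 < eta -> 0 < K <= 1 ->
  0 < tau -> tau <= 96 * A -> tau <= 96 * B -> 0 <= A -> 0 <= B -> 0 <= nu -> 0 <= nv ->
  5 * (A * nu + B * nv) <= S ->
  D ^+ 2 <= tau * D - eta * S ->
  nu ^+ 2 + nv ^+ 2 <= 9216 * (24 / (5 * eta)) ^+ 2 / K ^+ 2 * (A ^+ 2 + B ^+ 2).
Proof.
move=> eta0 /andP[K0 K1] tau0 tauA tauB A0 B0 nu0 nv0 hS hD.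
have h1 : eta * S <= tau ^+ 2 / 4.
  have := sqr_ge0 (D - tau / 2); rewrite sqrrB; lra.
have h2 : tau * (nu + nv) <= 96 * (A * nu + B * nv).
  have := ler_wpM2r nu0 tauA; have := ler_wpM2r nv0 tauB; lra.
have h3 : nu + nv <= 24 / (5 * eta) * tau.
  rewrite -(ler_pM2l tau0) mulrAC mulrA ler_pdivlMr ?mulr_gt0//.
  have h2' : tau * (nu + nv) * (5 * eta) <= 96 * (A * nu + B * nv) * (5 * eta).
    by rewrite ler_pM2r ?mulr_gt0.
  have h4 : 5 * (A * nu + B * nv) * eta <= S * eta by rewrite ler_pM2r.
  lra.
have h4 : (nu + nv) ^+ 2 <= (24 / (5 * eta) * tau) ^+ 2.
  have ct : 0 <= 24 / (5 * eta) * tau by rewrite ltW// !(divr_gt0, mulr_gt0).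
  by rewrite ler_pXn2r ?nnegrE ?addr_ge0.
have h5 : nu ^+ 2 + nv ^+ 2 <= (nu + nv) ^+ 2.
  have := mulr_ge0 nu0 nv0; rewrite sqrrD; lra.
have t2 : tau ^+ 2 <= 9216 * (A ^+ 2 + B ^+ 2).
  have : tau ^+ 2 <= (96 * A) ^+ 2 by rewrite ler_pXn2r ?nnegrE ?mulr_ge0// (ltW tau0).
  rewrite exprMn; have := sqr_ge0 B; lra.
set c := (24 / (5 * eta)) ^+ 2 in h4 *.
have c0 : 0 <= c by exact: sqr_ge0.
apply: (le_trans h5); apply: (le_trans h4); rewrite exprMn -/c.
apply: (@le_trans _ _ (c * (9216 * (A ^+ 2 + B ^+ 2)))); first by rewrite ler_wpM2l.
have L0 : 0 <= A ^+ 2 + B ^+ 2 by rewrite addr_ge0 ?sqr_ge0.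
have z0 : 0 <= 9216 * c by lra.
rewrite mulrA (mulrC c); set z := 9216 * c in z0 *; clearbody z.
rewrite ler_wpM2r// ler_peMr// invf_ge1 ?exprn_gt0// exprn_ile1//.
exact: ltW.
Qed.

(** Three of the four factors exp(- ell) are at most 1/2 each; with the prefactor 4 they leave half
    of exp(- ell). *)
Lemma failure_prob_le (ell a b : R) : ln 2 <= ell -> expR (- ell) <= a + b ->
  1 - 2^-1 * a - 2^-1 * b <= 1 - 4 * expR (- (4 * ell)).
Proof.
move=> ell2 ab.
have h : expR (- (3 * ell)) <= 8^-1 :> R.
  apply: (@le_trans _ _ (expR (- (3 * ln 2)))); first by rewrite ler_expR; lra.
  by rewrite expRN expRM_natl lnK ?posrE// -natrX.
have -> : - (4 * ell) = - (3 * ell) + - ell by ring.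
rewrite expRD; have := ler_wpM2r (expR_ge0 (- ell)) h; lra.
Qed.

Lemma penalised_noise_bound (rho tau D2 D e Jb Jbh Ju Jm Jmh Jv a b : R) : 0 <= rho ->
  D2 <= e + rho * (Jb - Jbh + (Jm - Jmh)) -> e <= 32 / 5 * (Ju + Jv) + tau * D ->
  Jb + Ju - Jbh <= 2 * a -> Jm + Jv - Jmh <= 2 * b ->
  D2 <= tau * D + 2 * rho * (a + b) - (rho - 32 / 5) * (Ju + Jv).
Proof.
move=> rho0 hD he ha hb.
have := ler_wpM2l rho0 ha; have := ler_wpM2l rho0 hb; lra.
Qed.

Lemma restricted_eigen_sum (k1 k2 x y d e : R) : k1 * e <= x + y -> `|d| <= k2 * e ->
  (k1 - 2 * k2) * e <= x + 2 * d + y.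
Proof. by move=> h; rewrite ler_norml => /andP[h1 h2]; lra. Qed.

(** Here 2 rho a is at most 2 rho S / 5, and rho - 32/5 - 2 rho/5 = (3 rho - 32)/5. *)
Lemma out_cone_bound (rho D2 T a S : R) : 0 <= rho ->
  D2 <= T + 2 * rho * a - (rho - 32 / 5) * S -> 5 * a <= S ->
  D2 <= T - (3 * rho - 32) / 5 * S.
Proof. by move=> rho0 h /(ler_wpM2l rho0); lra. Qed.

End slope_rate.

Theorem theorem4 (R : realType) (rho : R) (hrho : 2 * (4 + Num.sqrt 2) <= rho) :
  exists C' : R, 0 < C' /\
  forall (n p k s : nat) (X : 'M[R]_(n, p)) (sigma : R)
    (betas : 'cV[R]_p) (mus : 'cV[R]_n) (kappa1 kappa2 : R)
    (d : measure_display) (T : measurableType d) (P : probability T R)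
    (eps : 'I_n -> T -> R),
  (0 < k)%N -> (k <= p)%N -> (0 < s)%N -> (s <= n)%N ->
  0 < sigma ->
  (forall j : 'I_p, \sum_(i < n) X i j ^+ 2 = 1) ->
  (l0 betas <= k)%N -> (l0 mus <= s)%N ->
  (* noise: eps ~ N(0, sigma^2 I_n) *)
  (forall i, measurable_fun setT (eps i)) ->
  (forall i (A : set R), measurable A ->
     P (eps i @^-1` A) = normal_prob 0 sigma A) ->
  indep_rvs P eps ->
  (* restricted eigenvalue-type condition *)
  0 < 2 * kappa2 < kappa1 ->
  (let lam := lamw sigma n in
   let lamt := lamw sigma p in
   let k1 := k%:R * ln (2 * expR 1 * p%:R / k%:R) / ln 2 in
   let s1 := s%:R * ln (2 * expR 1 * n%:R / s%:R) / ln 2 in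
   forall (b : 'cV[R]_p) (m : 'cV[R]_n),
     Jsl (fun j => lamt j / lamt p) b + Jsl (fun j => lam j / lam n) m
       <= 5 * (Num.sqrt k1 * l2 b + Num.sqrt s1 * l2 m) ->
     sqn (X *m b) + sqn m >= kappa1 * (sqn b + sqn m) /\
     `|dotv (X *m b) m| <= kappa2 * (sqn b + sqn m)) ->
  let lam := lamw sigma n in
  let lamt := lamw sigma p in
  let kappa := Num.sqrt (kappa1 - 2 * kappa2) in
  let y := fun w => X *m betas + mus + \col_i eps i w in
  let obj := fun w (b : 'cV[R]_p) (m : 'cV[R]_n) =>
    sqn (y w - X *m b - m) + 2 * rho * Jsl lamt b + 2 * rho * Jsl lam m in
  exists E : set T, measurable E /\
    (P E >= (1 - 2^-1 * (s%:R / (2 * n%:R)) ^+ s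
                - 2^-1 * (k%:R / (2 * p%:R)) ^+ k)%:E)%E /\
    forall w, E w ->
      forall (bh : 'cV[R]_p) (mh : 'cV[R]_n),
        (forall b m, obj w bh mh <= obj w b m) ->
        sqn (bh - betas) + sqn (mh - mus)
          <= C' / kappa ^+ 4 *
             (\sum_(j < k) lamt j.+1 ^+ 2 + \sum_(j < s) lam j.+1 ^+ 2)
        /\
        C' / kappa ^+ 4 *
             (\sum_(j < k) lamt j.+1 ^+ 2 + \sum_(j < s) lam j.+1 ^+ 2)
          <= C' * sigma ^+ 2 / kappa ^+ 4 *
             (k%:R * ln (2 * expR 1 * p%:R / k%:R)
              + s%:R * ln (2 * expR 1 * n%:R / s%:R)).
Proof.
(* As 2 (4 + 4/3) = 32/3, this makes [3 * rho - 32] positive. *)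
have sqrt2 : 4 / 3 < Num.sqrt 2 :> R.
  rewrite -(@ltr_pXn2r _ 2)// ?nnegrE ?sqrtr_ge0 ?divr_ge0// sqr_sqrtr//; lra.
have eta0 : 0 < (3 * rho - 32) / 5 by lra.
have rho0 : 0 <= rho by lra.
have rho_ge : 32 / 5 <= rho by lra.
set eta := (3 * rho - 32) / 5 in eta0.
have [C1 C10 C1E] : exists2 C1, 0 < C1 & forall x, (18432 + 8 * rho ^+ 2) / x = C1 / x.
  exists (18432 + 8 * rho ^+ 2); last by [].
  by have := sqr_ge0 rho; lra.
have [C2 C20 C2E] : exists2 C2, 0 <= C2 & forall x, 9216 * (24 / (5 * eta)) ^+ 2 / x = C2 / x.
  exists (9216 * (24 / (5 * eta)) ^+ 2); last by [].
  by have := sqr_ge0 (24 / (5 * eta)); lra.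
exists (C1 + C2); split; first by rewrite ltr_wpDr.
move=> n p k s X sigma betas mus kappa1 kappa2 d T P eps.
move=> k0 kp s0 sn sigma0 X1 lbk lms meps law indep /andP[kap0 kap] RE lam lamt kappa y obj.
have p0 : (0 < p)%N by exact: leq_trans kp.
have n0 : (0 < n)%N by exact: leq_trans sn.
have lamt_ge0 j : 0 <= lamt j by rewrite lamw_ge0// ltW.
have lam_ge0 j : 0 <= lam j by rewrite lamw_ge0// ltW.
have lamt_ninc i j : (0 < i <= j)%N -> lamt j <= lamt i by apply: lamw_ninc => //; exact: ltW.
have lam_ninc i j : (0 < i <= j)%N -> lam j <= lam i by apply: lamw_ninc => //; exact: ltW.
pose SA := \sum_(j < k) lamt j.+1 ^+ 2; pose SB := \sum_(j < s) lam j.+1 ^+ 2.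
have SA0 : 0 <= SA by rewrite sumr_ge0// => j _; exact: sqr_ge0.
have SB0 : 0 <= SB by rewrite sumr_ge0// => j _; exact: sqr_ge0.
pose A := Num.sqrt SA; pose B := Num.sqrt SB.
have A2 : A ^+ 2 = SA by exact: sqr_sqrtr.
have B2 : B ^+ 2 = SB by exact: sqr_sqrtr.
have A0 : 0 <= A by exact: sqrtr_ge0.
have B0 : 0 <= B by exact: sqrtr_ge0.
have headA u : \sum_(j < k) lamt j.+1 * sorted_abs u j <= A * l2 (u : 'cV[R]_p) by exact: head_le_l2.
have headB v : \sum_(j < s) lam j.+1 * sorted_abs v j <= B * l2 (v : 'cV[R]_n) by exact: head_le_l2.
clearbody A B.
pose ek := k%:R * ln (2 * p%:R / k%:R) : R.
pose es := s%:R * ln (2 * n%:R / s%:R) : R.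
pose ell := Num.min ek es.
have ell2 : ln 2 <= ell by rewrite le_min !ln_2_le.
have ln20 : 0 < ln 2 :> R by rewrite ln_gt0// ltr1n.
have ell0 : 0 < ell by exact: lt_le_trans ell2.
(* Since 96^2 = 4 * 2304, the noise event fails with probability at most 4 exp(-4 [ell]). *)
pose tau := 96 * sigma * Num.sqrt ell.
have tau0 : 0 < tau by rewrite !mulr_gt0// sqrtr_gt0.
have tau2 : tau ^+ 2 = 96 ^+ 2 * (sigma ^+ 2 * ell).
  by rewrite !exprMn sqr_sqrtr ?ltW// mulrA.
clearbody tau.
have tauA : tau <= 96 * A.
  rewrite -(@ler_pXn2r _ 2) ?nnegrE ?(ltW tau0) ?mulr_ge0// tau2 exprMn A2.
  rewrite ler_wpM2l ?sqr_ge0//; apply: le_trans (sum_sqr_lamw_ge sigma k0 kp).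
  by rewrite ler_wpM2l ?sqr_ge0// ge_min lexx.
have tauB : tau <= 96 * B.
  rewrite -(@ler_pXn2r _ 2) ?nnegrE ?(ltW tau0) ?mulr_ge0// tau2 exprMn B2.
  rewrite ler_wpM2l ?sqr_ge0//; apply: le_trans (sum_sqr_lamw_ge sigma s0 sn).
  by rewrite ler_wpM2l ?sqr_ge0// ge_min lexx orbT.
have [E mE [PE hE]] := noise_event sigma0 tau0 n0 p0 X1 meps law indep.
exists E; split => //; split.
  apply: le_trans PE; rewrite lee_fin.
  have -> : tau ^+ 2 / (2304 * sigma ^+ 2) = 4 * ell.
    by rewrite tau2; field; rewrite gt_eqF.
  apply: failure_prob_le => //.
  rewrite -!expR_mul_ln// /ell minEle -/ek -/es; case: ifP => _.
    by rewrite lerDr expR_ge0.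
  by rewrite lerDl expR_ge0.
pose ls := sigma * Num.sqrt (ln 2) : R.
have ls0 : 0 < ls by rewrite mulr_gt0// sqrtr_gt0.
have lamtp : lamt p = ls by rewrite /lamt /lamw mulfK// pnatr_eq0 -lt0n.
have lamn : lam n = ls by rewrite /lam /lamw mulfK// pnatr_eq0 -lt0n.
have JslZ q (l : nat -> R) c (u : 'cV[R]_q) : Jsl (fun j => l j / c) u = Jsl l u / c.
  by rewrite /Jsl mulr_suml; apply: eq_bigr => j _; rewrite mulrAC.
have ls2 : ls ^+ 2 = sigma ^+ 2 * ln 2 by rewrite exprMn sqr_sqrtr// ltW.
clearbody ls.
have sqrt_le (S a x : R) : a ^+ 2 = S -> 0 <= a -> 0 <= x ->
    S <= sigma ^+ 2 * x -> a <= ls * Num.sqrt (x / ln 2).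
  move=> aS a0 x0 Sx; rewrite -(@ler_pXn2r _ 2)// ?nnegrE ?mulr_ge0 ?sqrtr_ge0 ?(ltW ls0)//.
  rewrite aS exprMn ls2 sqr_sqrtr ?divr_ge0 ?(ltW ln20)//.
  by rewrite (mulrC x) -mulrA mulVKf ?gt_eqF.
have log_ge0 (q r : nat) : (0 < q)%N -> (q <= r)%N ->
    0 <= q%:R * ln (2 * expR 1 * r%:R / q%:R) :> R.
  move=> q0 qr; rewrite -(pmulr_rge0 _ (exprn_gt0 2 sigma0)).
  by apply: le_trans (sum_sqr_lamw_le sigma q0 qr); rewrite sumr_ge0// => j _; exact: sqr_ge0.
have Ak1 := sqrt_le _ _ _ A2 A0 (log_ge0 _ _ k0 kp) (sum_sqr_lamw_le sigma k0 kp).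
have Bs1 := sqrt_le _ _ _ B2 B0 (log_ge0 _ _ s0 sn) (sum_sqr_lamw_le sigma s0 sn).
(* [ls] is the last weight of both sequences, and A and B are at most [ls] times the square roots of
   the two complexities in the hypothesis. The cone defined with A and B is therefore contained in
   the assumed one. *)
have cone b m : Jsl lamt b + Jsl lam m <= 5 * (A * l2 b + B * l2 m) ->
    sqn (X *m b) + sqn m >= kappa1 * (sqn b + sqn m) /\
    `|dotv (X *m b) m| <= kappa2 * (sqn b + sqn m).
  move=> h; apply: RE; rewrite !JslZ.
  rewrite -[lamw sigma p p]/(lamt p) -[lamw sigma n n]/(lam n) lamtp lamn -mulrDl ler_pdivrMr//.
  apply: (le_trans h); rewrite -[leRHS]mulrA ler_pM2l// [leRHS]mulrDl; apply: lerD.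
    by rewrite [leRHS]mulrAC (mulrC _ ls) ler_wpM2r ?l2_ge0// Ak1.
  by rewrite [leRHS]mulrAC (mulrC _ ls) ler_wpM2r ?l2_ge0// Bs1.
clear RE Ak1 Bs1 sqrt_le log_ge0.
have sqn0 q : sqn (0 : 'cV[R]_q) = 0 by rewrite /sqn big1// => i _; rewrite mxE expr0n.
(* The pair of 0 and a unit vector lies in the cone, because the first weight is at most B, and its
   quadratic form is 1. Hence K <= 1, which lets every estimate be stated with K^-2. *)
have kappa1_le1 : kappa1 <= 1.
  pose e1 : 'cV[R]_n := delta_mx (Ordinal n0) 0.
  have se1 : sqn e1 = 1.
    rewrite /sqn (bigD1 (Ordinal n0))//= mxE !eqxx expr1n big1 ?addr0// => i /negbTE ni.
    by rewrite mxE ni expr0n.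
  have l1 : l2 e1 = 1 by rewrite /l2 se1 sqrtr1.
  have Je : Jsl lam e1 <= lam 1%N.
    apply: le_trans (Jsl_le_l1 lam_ninc e1) _.
    rewrite (bigD1 (Ordinal n0))//= mxE !eqxx normr1 big1 ?addr0 ?mulr1// => i /negbTE ni.
    by rewrite mxE ni normr0.
  have J0 : Jsl lamt (0 : 'cV[R]_p) <= 0.
    apply: le_trans (Jsl_le_l1 lamt_ninc 0) _.
    by rewrite big1 ?mulr0// => i _; rewrite mxE normr0.
  have lB : lam 1%N <= B.
    rewrite -(@ler_pXn2r _ 2)// ?nnegrE// B2 /SB.
    case: (s) s0 => // s' _; rewrite big_ord_recl lerDl sumr_ge0// => j _; exact: sqr_ge0.
  have [] := cone 0 e1.
    rewrite l1 /l2 sqn0 sqrtr0 mulr0 add0r mulr1; apply: (le_trans (lerD J0 Je)).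
    by rewrite add0r (le_trans lB)// ler_peMl// ler1n.
  by rewrite mulmx0 !sqn0 se1 !add0r mulr1.
pose K := kappa1 - 2 * kappa2.
have K0 : 0 < K by rewrite subr_gt0.
have K1 : K <= 1.
  by apply: le_trans kappa1_le1; rewrite lerBlDr lerDl ltW.
have kap4 : kappa ^+ 4 = K ^+ 2.
  by rewrite (_ : 4 = 2 * 2)%N// exprM sqr_sqrtr// ltW.
rewrite kap4 => w Ew bh mh opt; split; last first.
  have h1 := sum_sqr_lamw_le sigma k0 kp; have h2 := sum_sqr_lamw_le sigma s0 sn.
  rewrite -/SA -/SB -[leRHS]mulrA -[leRHS]mulrA -[leLHS]mulrA ler_wpM2l ?addr_ge0 ?(ltW C10)//.
  rewrite mulrCA ler_pM2l ?invr_gt0 ?exprn_gt0// mulrDr.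
  exact: lerD.
rewrite -/SA -/SB -A2 -B2.
pose u := bh - betas; pose v := mh - mus; pose D := X *m u + v.
have hD := slope_basic_inequality rho0 lamt_ge0 lam_ge0 lamt_ninc lam_ninc opt (erefl D).
have hn := hE w Ew u v.
have hu : Jsl lamt betas + Jsl lamt u - Jsl lamt bh <= 2 * (A * l2 u).
  have := @Jsl_decomposable _ _ _ lamt_ge0 lamt_ninc k betas u.
  rewrite lbk kp (_ : betas + u = bh) => [/(_ isT) h|]; last by rewrite /u addrC subrK.
  apply: (le_trans h).
  by rewrite ler_pM2l.
have hv : Jsl lam mus + Jsl lam v - Jsl lam mh <= 2 * (B * l2 v).
  have := @Jsl_decomposable _ _ _ lam_ge0 lam_ninc s mus v.
  rewrite lms sn (_ : mus + v = mh) => [/(_ isT) h|]; last by rewrite /v addrC subrK.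
  apply: (le_trans h).
  by rewrite ler_pM2l.
rewrite -sqr_l2 in hD.
pose nu := l2 u; pose nv := l2 v.
have key : l2 D ^+ 2 <= tau * l2 D + 2 * rho * (A * nu + B * nv) -
    (rho - 32 / 5) * (Jsl lamt u + Jsl lam v).
  exact: (penalised_noise_bound rho0 hD hn hu hv).
have S0 : 0 <= Jsl lamt u + Jsl lam v by rewrite addr_ge0 ?Jsl_ge0.
have nu0 : 0 <= nu by exact: l2_ge0.
have nv0 : 0 <= nv by exact: l2_ge0.
have L0 : 0 <= A ^+ 2 + B ^+ 2 by rewrite addr_ge0 ?sqr_ge0.
have KL0 : 0 <= (A ^+ 2 + B ^+ 2) / K ^+ 2 by rewrite divr_ge0// sqr_ge0.
rewrite -/u -/v -(sqr_l2 u) -(sqr_l2 v) -/nu -/nv.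
have K01 : 0 < K <= 1 by rewrite K0.
have [hc|hc] := leP (Jsl lamt u + Jsl lam v) (5 * (A * nu + B * nv)).
  have [r1 r2] := cone u v hc.
  have rD : K * (nu ^+ 2 + nv ^+ 2) <= l2 D ^+ 2.
    by rewrite /nu /nv !sqr_l2 /D (sqnD (X *m u) v); exact: (restricted_eigen_sum r1 r2).
  have tA : 0 <= tau <= 96 * A by rewrite (ltW tau0).
  have key' : l2 D ^+ 2 <= tau * l2 D + 2 * rho * (A * nu + B * nv).
    by apply: (le_trans key); rewrite lerBlDr lerDl mulr_ge0// subr_ge0.
  apply: le_trans (rate_in_cone rho0 K01 (l2_ge0 D) tA A0 B0 nu0 nv0 rD key') _.
  by rewrite C1E ler_wpM2r// ler_wpM2r ?invr_ge0 ?sqr_ge0// lerDl.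
have hc' := ltW hc.
have key' : l2 D ^+ 2 <= tau * l2 D - eta * (Jsl lamt u + Jsl lam v).
  exact: (out_cone_bound rho0 key hc').
apply: le_trans (rate_out_cone eta0 K01 tau0 tauA tauB A0 B0 nu0 nv0 hc' key') _.
by rewrite C2E ler_wpM2r// ler_wpM2r ?invr_ge0 ?sqr_ge0// lerDr ltW.
Qed.
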